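(* Let $n\geq 2$ and let $f\in R=\mathbb{C}[x_1,\dots,x_n]$ be homogeneous of degree $d$, with $\dim\operatorname{Sing} f^{-1}(0)\leq 1$ and $f$ not a polynomial of $n-1$ variables. Then $\mu'_k=\mu'_{nd-k}$ for all $k\in\mathbb{Z}$.
   Context: $R=\mathbb{C}[x_1,\dots,x_n]$ is graded by $\deg x_i=1$. $\Omega^j$ is the graded free $R$-module of algebraic differential $j$-forms on $\mathbb{C}^n$, with $\deg x_i=\deg dx_i=1$. $\operatorname{Sing} f^{-1}(0)\subset\mathbb{C}^n$ is the common zero set of the partial derivatives of $f$. ''$f$ is not a polynomial of $n-1$ variables'' means that no linear change of coordinates makes $f$ depend on only $n-1$ variables. $M:=\Omega^n/df\wedge\Omega^{n-1}$, graded so that $M_k$ consists of classes of $n$-forms of degree $k$. With $\mathfrak{m}=(x_1,\dots,x_n)$, $M':=H^0_{\mathfrak m}M=\{a\in M\mid \mathfrak{m}^ja=0 \text{ for } j\gg 0\}$, and $\mu'_k:=\dim_{\mathbb{C}}M'_k$. *)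

(* Defs.v *)
From HB Require Import structures.
From mathcomp Require Import all_boot all_order all_algebra.
From mathcomp Require Import ring_quotient generic_quotient.
From mathcomp Require Import boolp classical_sets reals.
From mathcomp Require Export complex mpoly.

Set Implicit Arguments.
Unset Strict Implicit.
Unset Printing Implicit Defensive.

Import GRing.Theory.

Local Open Scope ring_scope.
Local Open Scope classical_set_scope.
Local Open Scope quotient_scope.

Definition multi_index (n j : nat) : finType :=
  {I : {set 'I_n} | #|I| == j}.

Definition index_set (n j : nat) (I : multi_index n j) : {set 'I_n} := val I.

(* {mpoly K[n]} carries its K-module structure; the regular module over the
   polynomial ring is {mpoly K[n]}^o.  A j-form is the family of its
   coefficients on the basis dx_I = dx_i1 /\ .. /\ dx_ij, where
   I = {i1 < .. < ij}. *)
Definition Omega (K : fieldType) (n j : nat) : Type :=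
  {ffun multi_index n j -> {mpoly K[n]}^o}.

HB.instance Definition _ (K : fieldType) (n j : nat) :=
  GRing.Lmodule.copy (Omega K n j) {ffun multi_index n j -> {mpoly K[n]}^o}.

(* dx_I /\ dx_J = (-1)^(inversions I J) dx_(I :|: J) for disjoint I and J. *)
Definition inversions (n : nat) (I J : {set 'I_n}) : nat :=
  #|[set p : 'I_n * 'I_n | [&& p.1 \in I, p.2 \in J & (p.2 < p.1)%N]]|.

(* The degree of the target is a free index c, in order to avoid transports
   between Omega K n (1 + n.-1) and Omega K n n; only c = a + b is meaningful
   (the result is 0 for other values of c). *)
Definition wedge (K : fieldType) (n a b c : nat)
    (u : Omega K n a) (v : Omega K n b) : Omega K n c :=
  [ffun L : multi_index n c =>
     \sum_(I : multi_index n a) \sum_(J : multi_index n b |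
         [disjoint index_set I & index_set J]
         && (index_set I :|: index_set J == index_set L)%SET)
       (-1) ^+ inversions (index_set I) (index_set J)
       * (u I : {mpoly K[n]}) * v J].

Definition dx (K : fieldType) (n : nat) (i : 'I_n) : Omega K n 1 :=
  [ffun I : multi_index n 1 => (index_set I == [set i]%SET)%:R].

Definition differential (K : fieldType) (n : nat) (f : {mpoly K[n]}) :
    Omega K n 1 :=
  \sum_i f^`M(i) *: dx K i.

(* Graded with deg x_i = deg dx_i = 1, so that the coefficients of a j-form of
   degree k are homogeneous of degree k - j; there are no nonzero homogeneous
   polynomials of negative degree. *)
Definition zhomog (K : fieldType) (n : nat) (k : int) (p : {mpoly K[n]}) :
    Prop :=
  match k with
  | Posz e => p \is e.-homog
  | Negz _ => p = 0
  end.

Definition Omega_deg (K : fieldType) (n j : nat) (k : int) :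
    set (Omega K n j) :=
  [set w | forall I, zhomog (k - j%:Z) (w I : {mpoly K[n]})].

Definition df_wedge (K : fieldType) (n : nat) (f : {mpoly K[n]}) :
    Omega K n n -> bool :=
  fun w => `[< exists eta : Omega K n n.-1,
                 w = wedge n (differential f) eta >].

Lemma wedge_linear (K : fieldType) (n a b c : nat) (u : Omega K n a) :
  linear (wedge c u : Omega K n b -> Omega K n c).
Proof.
move=> p v w; apply/ffunP => L; rewrite !ffunE.
rewrite scaler_sumr -big_split; apply: eq_bigr => I _ /=.
rewrite scaler_sumr -big_split; apply: eq_bigr => J _ /=.
by rewrite !ffunE mulrDr; congr (_ + _); rewrite /= mulrCA.
Qed.

Lemma df_wedge_submod_closed (K : fieldType) (n : nat) (f : {mpoly K[n]}) :
  submod_closed (df_wedge f).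
Proof.
have E p (v w : Omega K n n.-1) := wedge_linear n (differential f) p v w.
split=> [|p v w /asboolP[v' ->] /asboolP[w' ->]]; apply/asboolP.
  exists 0; have := E (-1) 0 0.
  by rewrite !scaler0 addr0 => {1}->; rewrite scaleN1r addNr.
by exists (p *: v' + w'); rewrite E.
Qed.

HB.instance Definition _ (K : fieldType) (n : nat) (f : {mpoly K[n]}) :=
  GRing.isSubmodClosed.Build {mpoly K[n]} (Omega K n n) (df_wedge f)
    (df_wedge_submod_closed f).

Definition df_wedge_zmod (K : fieldType) (n : nat) (f : {mpoly K[n]}) :
    zmodClosed (Omega K n n) :=
  Algebra.ZmodClosed.clone (Omega K n n) (df_wedge f) _.

(* M = Omega^n / df /\ Omega^(n-1) *)
Definition Mquot (K : fieldType) (n : nat) (f : {mpoly K[n]}) : Type :=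
  Quotient.quot (df_wedge_zmod f).

HB.instance Definition _ (K : fieldType) (n : nat) (f : {mpoly K[n]}) :=
  GRing.Zmodule.on (Mquot f).

Definition Mclass (K : fieldType) (n : nat) (f : {mpoly K[n]})
    (w : Omega K n n) : Mquot f :=
  \pi_(Quotient.quot (df_wedge_zmod f)) w.

Definition Mrepr (K : fieldType) (n : nat) (f : {mpoly K[n]}) (a : Mquot f) :
    Omega K n n :=
  repr (a : Quotient.quot (df_wedge_zmod f)).

Definition Mscale (K : fieldType) (n : nat) (f : {mpoly K[n]})
    (p : {mpoly K[n]}) (a : Mquot f) : Mquot f :=
  Mclass f (p *: Mrepr a).

Lemma MreprK (K : fieldType) (n : nat) (f : {mpoly K[n]}) :
  cancel (@Mrepr K n f) (Mclass f).
Proof. exact: reprK. Qed.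

Lemma MclassD (K : fieldType) (n : nat) (f : {mpoly K[n]}) :
  {morph Mclass f : v w / v + w}.
Proof. exact: (raddfD (\pi_(Quotient.quot (df_wedge_zmod f)))). Qed.

Lemma Mclass_eq (K : fieldType) (n : nat) (f : {mpoly K[n]})
    (v w : Omega K n n) :
  Mclass f v = Mclass f w <->
  exists eta : Omega K n n.-1, v - w = wedge n (differential f) eta.
Proof.
have E : ((v - w) \in df_wedge_zmod f) = (Mclass f v == Mclass f w).
  exact: Quotient.idealrBE.
split=> [/eqP | H]; last by apply/eqP; rewrite -E; apply/asboolP.
by rewrite -E => /asboolP.
Qed.

Lemma MclassZ (K : fieldType) (n : nat) (f : {mpoly K[n]}) (p : {mpoly K[n]})
    (w : Omega K n n) :
  Mclass f (p *: w) = Mscale p (Mclass f w).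
Proof.
have /Mclass_eq[eta E] := esym (MreprK (Mclass f w)).
apply/Mclass_eq; exists (p *: eta).
have := wedge_linear n (differential f) p eta 0.
rewrite -scalerBr E addr0 => ->.
suff -> : wedge n (differential f) (0 : Omega K n n.-1) = 0 by rewrite addr0.
have := wedge_linear n (differential f) (-1) (0 : Omega K n n.-1) 0.
by rewrite !scaler0 addr0 => {1}->; rewrite scaleN1r addNr.
Qed.

Lemma Mscale_assoc (K : fieldType) (n : nat) (f : {mpoly K[n]})
    (p q : {mpoly K[n]}) (a : Mquot f) :
  Mscale p (Mscale q a) = Mscale (p * q) a.
Proof. by rewrite -(MreprK a) -!MclassZ scalerA. Qed.

Lemma Mscale1 (K : fieldType) (n : nat) (f : {mpoly K[n]}) :
  left_id 1 (@Mscale K n f).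
Proof. by move=> a; rewrite -{1}(MreprK a) -MclassZ scale1r MreprK. Qed.

Lemma MscaleDr (K : fieldType) (n : nat) (f : {mpoly K[n]}) :
  right_distributive (@Mscale K n f) +%R.
Proof.
move=> p a b; rewrite -(MreprK a) -(MreprK b) -MclassD -!MclassZ -MclassD.
by rewrite scalerDr.
Qed.

Lemma MscaleDl (K : fieldType) (n : nat) (f : {mpoly K[n]}) (a : Mquot f) :
  {morph (@Mscale K n f)^~ a : p q / p + q}.
Proof. by move=> p q; rewrite -(MreprK a) -!MclassZ -MclassD scalerDl. Qed.

HB.instance Definition _ (K : fieldType) (n : nat) (f : {mpoly K[n]}) :=
  GRing.Zmodule_isLmodule.Build {mpoly K[n]} (Mquot f)
    (@Mscale_assoc K n f) (@Mscale1 K n f) (@MscaleDr K n f)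
    (@MscaleDl K n f).

Definition Mdeg (K : fieldType) (n : nat) (f : {mpoly K[n]}) (k : int) :
    set (Mquot f) :=
  Mclass f @` @Omega_deg K n n k.
Arguments Mdeg {K n} f k _.

Definition irrelevant_ideal (K : fieldType) (n : nat) : set {mpoly K[n]} :=
  [set p | exists g : 'I_n -> {mpoly K[n]}, p = \sum_i g i * 'X_i].

Fixpoint ideal_pow (A : comNzRingType) (I : set A) (j : nat) : set A :=
  if j is j'.+1 then
    [set p | exists r : nat, exists a b : 'I_r -> A,
       [/\ forall i, I (a i), forall i, ideal_pow I j' (b i)
         & p = \sum_i a i * b i]]
  else setT.

Definition local_cohomology0 (A : comNzRingType) (I : set A) (V : lmodType A) :
    set V :=
  [set a | exists j0 : nat, forall j : nat, (j0 <= j)%N ->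
     forall p, ideal_pow I j p -> p *: a = 0].

(* M'_k = M' :&: M_k *)
Definition M'deg (K : fieldType) (n : nat) (f : {mpoly K[n]}) (k : int) :
    set (Mquot f) :=
  @local_cohomology0 _ (@irrelevant_ideal K n) (Mquot f) `&` Mdeg f k.
Arguments M'deg {K n} f k _.

(* K acts on a module over the K-algebra A through c |-> c%:A. *)
Definition is_basis (K : fieldType) (A : algType K) (V : lmodType A)
    (S : set V) (r : nat) (b : 'I_r -> V) : Prop :=
  [/\ forall i, S (b i),
      forall c : 'I_r -> K, \sum_i (c i)%:A *: b i = 0 -> forall i, c i = 0
    & forall a, S a -> exists c : 'I_r -> K, a = \sum_i (c i)%:A *: b i].

(* The default value 0 is only taken when S has no finite basis. *)
Definition kdim (K : fieldType) (A : algType K) (V : lmodType A) (S : set V) :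
    nat :=
  xget 0%N [set r | exists b : 'I_r -> V, is_basis S b].

Lemma basis_exists (K : fieldType) (A : algType K) (V : lmodType A)
    (S : set V) (T : finType) (g : T -> V) :
  (forall r (c : 'I_r -> K) (b : 'I_r -> V),
     (forall i, S (b i)) -> S (\sum_i (c i)%:A *: b i)) ->
  (forall a, S a -> exists c : T -> K, a = \sum_t (c t)%:A *: g t) ->
  exists b : 'I_(kdim S) -> V, is_basis S b.
Proof.
move=> Slin Sspan.
suff [r Pr] : exists r, exists b : 'I_r -> V, is_basis S b.
  have := (@xgetPex _ 0%N [set r | exists b : 'I_r -> V, is_basis S b]).
  by apply; exists r.
pose indep r (b : 'I_r -> V) := forall c : 'I_r -> K,
  \sum_i (c i)%:A *: b i = 0 -> forall i, c i = 0.
pose P r := `[< exists b : 'I_r -> V, (forall i, S (b i)) /\ indep r b >].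
have P0 : exists r, P r.
  exists 0%N; apply/asboolP; exists (fun=> 0).
  by split=> [[]//|c _ []].
have Pub r : P r -> (r <= #|T|)%N.
  move=> /asboolP[b [Sb ib]]; rewrite leqNgt; apply/negP => ltTr.
  have /boolp.choice[C Cb] i := Sspan _ (Sb i).
  pose M : 'M[K]_(r, #|T|) := \matrix_(i, j) C i (enum_val j).
  have : kermx M != 0.
    rewrite kermx_eq0 /row_free ltn_eqF //.
    exact: leq_ltn_trans (rank_leq_col M) ltTr.
  case/rowV0Pn=> u /sub_kermxP uM /eqP; apply; apply/rowP => i; rewrite mxE.
  apply: (ib (u 0)) i.
  under eq_bigr => i _ do rewrite Cb scaler_sumr.
  rewrite exchange_big big1 // => t _.
  under eq_bigr => i _ do
    rewrite scalerA -scalerAl mul1r scalerA.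
  rewrite -scaler_suml -scaler_suml.
  have /rowP/(_ (enum_rank t)) := uM; rewrite !mxE => E.
  rewrite (_ : \sum_i _ = 0) ?scale0r // -[RHS]E.
  by apply: eq_bigr => i _; rewrite mxE enum_rankK.
have [r /asboolP[b [Sb ib]] rmax] := ex_maxnP P0 Pub.
exists r, b; split => // a Sa.
pose b' (i : 'I_r.+1) := if unlift ord0 i is Some j then b j else a.
have Sb' i : S (b' i) by rewrite /b'; case: unlift.
have /existsNP[c] : ~ indep r.+1 b'.
  move=> ib'; have := rmax r.+1; rewrite ltnn => /(_ _)/notF; apply.
  by apply/asboolP; exists b'.
move=> /not_implyP[]; rewrite big_ord_recl /b' unlift_none.
under eq_bigr => i _ do rewrite liftK.
move=> E nc.
have c0 : c ord0 != 0.
  apply/negP => /eqP c0; apply: nc => i.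
  move: E; rewrite c0 !scale0r add0r => /ib E.
  by case: (unliftP ord0 i) => [j ->|->].
exists (fun i => - (c ord0)^-1 * c (lift ord0 i)).
have : (c ord0)^-1%:A *: ((c ord0)%:A *: a + \sum_(i < r) (c (lift ord0 i))%:A *: b i) = 0 by rewrite E scaler0.
rewrite scalerDr scalerA -scalerAl mul1r scalerA mulVf // !scale1r.
move/eqP; rewrite addr_eq0 => /eqP ->.
rewrite scaler_sumr -sumrN; apply: eq_bigr => i _.
by rewrite scalerA -scalerAl mul1r scalerA mulNr scaleNr scaleNr.
Qed.

Definition mu' (K : fieldType) (n : nat) (f : {mpoly K[n]}) (k : int) : nat :=
  kdim (M'deg f k).

(* The default value 0 of kdim is not taken here. *)
Lemma mu'_basis (K : fieldType) (n : nat) (f : {mpoly K[n]}) (k : int) :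
  exists b : 'I_(mu' f k) -> Mquot f, is_basis (M'deg f k) b.
Proof.
have AE (c : K) (p : {mpoly K[n]}) : c%:A *: (p : {mpoly K[n]}^o) = c *: p.
  by rewrite -[LHS]/(c%:A * p) -scalerAl mul1r.
pose N := absz (k - n%:Z).
pose e (t : multi_index n n * 'X_{1..n < N.+1}) : Omega K n n :=
  [ffun I : multi_index n n => if I == t.1 then 'X_[t.2] else 0].
have wclass r (c : 'I_r -> K) (w : 'I_r -> Omega K n n) :
    \sum_i (c i)%:A *: Mclass f (w i) = Mclass f (\sum_i (c i)%:A *: w i).
  rewrite /Mclass raddf_sum; apply: eq_bigr => i _; exact/esym/MclassZ.
apply: (basis_exists (g := fun t => Mclass f (e t))).
  move=> r c b Sb; split.
    have /boolp.choice[J Jb] i := (Sb i).1.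
    exists (\max_i J i)%N => j lej p Ip; rewrite scaler_sumr big1 // => i _.
    rewrite scalerA mulrC -scalerA (Jb i j) ?scaler0 //.
    exact: leq_trans (leq_bigmax i) lej.
  have /boolp.choice[w Hw] i : exists w, Omega_deg k w /\ Mclass f w = b i.
    by have [w wk wb] := (Sb i).2; exists w.
  exists (\sum_i (c i)%:A *: w i); last first.
    by rewrite -wclass; apply: eq_bigr => i _; rewrite (Hw i).2.
  move=> I; rewrite sum_ffunE.
  have {}Hw i := (Hw i).1 I.
  move: Hw; rewrite /zhomog; case: (k - n%:Z) => h Hw.
    apply: rpred_sum => i _; rewrite ffunE AE; apply: rpredZ; exact: Hw.
  by rewrite big1 // => i _; rewrite ffunE Hw scaler0.
move=> _ [_ [w wk <-]].
exists (fun t : multi_index n n * 'X_{1..n < N.+1} =>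
  (w t.1 : {mpoly K[n]})@_(t.2)).
have {1}-> : w = \sum_(t : multi_index n n * 'X_{1..n < N.+1})
    ((w t.1 : {mpoly K[n]})@_(t.2))%:A *: e t.
  apply/ffunP => I; rewrite sum_ffunE.
  rewrite -(pair_bigA _ (fun J (m : 'X_{1..n < N.+1}) =>
    (((w J : {mpoly K[n]})@_m)%:A *: e (J, m)) I)) /=.
  rewrite (bigD1 I) //= [X in _ + X]big1 ?addr0; last first.
    move=> J nJ; rewrite big1 // => m _.
    by rewrite !ffunE eq_sym (negPf nJ) scaler0.
  transitivity (\sum_(m : 'X_{1..n < N.+1})
      (w I : {mpoly K[n]})@_m *: 'X_[m] : {mpoly K[n]}); last first.
    apply: eq_bigr => m _; rewrite !ffunE eqxx.
    exact/esym/AE.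
  apply: (mpolywE (k := N.+1)).
  have := wk I; rewrite /N /zhomog; case: (k - n%:Z) => h; last by move=> ->; rewrite msize0.
  move=> /dhomogP H; rewrite msizeE; apply/bigmax_leqP_seq => m mw _.
  by rewrite ltnS (H m mw).
rewrite /Mclass raddf_sum; apply: eq_bigr => t _; exact: MclassZ.
Qed.

Definition zero_locus (K : fieldType) (n : nat) (P : set {mpoly K[n]}) :
    set ('I_n -> K) :=
  [set v | forall p, P p -> p.@[v] = 0].

Definition zariski_closed (K : fieldType) (n : nat) (Z : set ('I_n -> K)) :
    Prop :=
  exists P : set {mpoly K[n]}, Z = zero_locus P.

Definition zariski_irreducible (K : fieldType) (n : nat)
    (Z : set ('I_n -> K)) : Prop :=
  Z !=set0 /\
  forall Z1 Z2 : set ('I_n -> K), zariski_closed Z1 -> zariski_closed Z2 ->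
    Z `<=` Z1 `|` Z2 -> Z `<=` Z1 \/ Z `<=` Z2.

(* Krull dimension, for a Zariski closed set Z; the empty set has dimension
   -oo.  The irreducible closed subsets of Z are those of the affine space that
   are included in Z. *)
Definition dim_le (K : fieldType) (n : nat) (Z : set ('I_n -> K)) (e : nat) :
    Prop :=
  forall (l : nat) (Y : nat -> set ('I_n -> K)),
    (forall i, (i <= l)%N ->
       [/\ zariski_closed (Y i), zariski_irreducible (Y i) & Y i `<=` Z]) ->
    (forall i, (i < l)%N -> Y i `<` Y i.+1) ->
  (l <= e)%N.

Definition Sing (K : fieldType) (n : nat) (f : {mpoly K[n]}) :
    set ('I_n -> K) :=
  [set v | forall i, (f^`M(i)).@[v] = 0].

(* f(A x), where x is the column of the variables *)
Definition linear_change (K : fieldType) (n : nat) (A : 'M[K]_n)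
    (f : {mpoly K[n]}) : {mpoly K[n]} :=
  f \mPo [tuple \sum_(j < n) A i j *: 'X_j | i < n].

Definition depends_on_fewer_variables (K : fieldType) (n : nat)
    (f : {mpoly K[n]}) : Prop :=
  exists i : 'I_n, forall m : 'X_{1..n}, m \in msupp f -> m i = 0%N.

Definition polynomial_of_fewer_variables (K : fieldType) (n : nat)
    (f : {mpoly K[n]}) : Prop :=
  exists2 A : 'M[K]_n, A \in unitmx &
    depends_on_fewer_variables (linear_change A f).

(* Main.v *)
Require Import Defs.
From mathcomp Require Import all_boot all_order all_algebra.
From mathcomp Require Import boolp classical_sets reals.
From mathcomp Require Import ring zify.

(** Identifying an n-form with its coefficient turns M into R/J shifted by n,
    where J is the ideal of the n partial derivatives of f, which are forms of
    degree d - 1 (for d <= 1 they are constants, and then M = 0 or f depends on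
    no variable).  The claim becomes a duality between the degrees e and
    n(d-2) - e of the torsion H of R/J.

    Since the zero locus of J has dimension at most one, it is a finite union of
    lines ([dim_le1_finite_lines]), so a generic linear form l has no zero on it
    except 0.  By the projective Nullstellensatz, J and l together generate an
    ideal containing a power of the irrelevant ideal, and H is the part of R/J
    killed by z = l^N for N large.

    Generic combinations of the partial derivatives give generators g_1, ..., g_n
    of J such that g_1, ..., g_(n-1), z is a complete intersection
    ([gorenstein_presentation]).  With I = (g_1, ..., g_(n-1)), the form z is
    regular modulo I, and R/(I, z) is an Artinian Gorenstein ring of socle degree
    (n-1)(d-2) + N - 1.  Both facts are known for powers of the variables by
    inspection of monomials, and are carried over to the complete intersection
    by exchanging one generator at a time ([exchange]).

    Let phi be the functional defining the duality of R/(I, z), and g = g_n.  If a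
    and b represent elements of H, then z b = g b' modulo I for some b', and
    (a, b) |-> phi(a b') is a pairing between H_e and H_(n(d-2)-e).  It has no
    kernel on the left because an element orthogonal to the annihilator of g in
    R/(I, z) is a multiple of g ([pairing_ineq]).  Hence
    mu'_k <= mu'_(nd-k) for all k, and the equality follows by exchanging k and
    nd - k. *)

Set Implicit Arguments.
Unset Strict Implicit.
Unset Printing Implicit Defensive.

Import GRing.Theory.

Local Open Scope ring_scope.
Local Open Scope classical_set_scope.

Local Notation hpart d p := (pihomog mdeg d p).

(** * Homogeneous components of a polynomial *)

Section HomogeneousParts.
Variables (K : comNzRingType) (n : nat).
Implicit Types (p q h : {mpoly K[n]}) (v : 'I_n -> K).

Lemma hpart_sum p : p = \sum_(d < msize p) hpart d p.
Proof. exact: pihomog_partitionE. Qed.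

Lemma hpart_mul_ge d k p h :
  h \is k.-homog -> (k <= d)%N -> hpart d (p * h) = hpart (d - k) p * h.
Proof.
move=> hh lkd; elim/mpolyind: p => [|c m p _ _ IH].
  by rewrite mul0r !pihomog0 mul0r.
rewrite mulrDl !pihomogD mulrDl IH; congr (_ + _).
rewrite -scalerAl !linearZ /= -scalerAl; congr (_ *: _).
rewrite pihomogX /=.
have hm : 'X_[m] * h \is (mdeg m + k).-homog.
  by apply: dhomogM => //; rewrite dhomogX.
have -> : (mdeg m == d - k)%N = (mdeg m + k == d)%N.
  by apply/eqP/eqP => [->|<-]; rewrite ?subnK ?addnK.
case: eqVneq => [<-|ne]; first by rewrite pihomog_dE.
by rewrite (pihomog_ne0 ne hm) mul0r.
Qed.

Lemma hpart_mul_lt d k p h :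
  h \is k.-homog -> (d < k)%N -> hpart d (p * h) = 0.
Proof.
move=> hh ltdk; elim/mpolyind: p => [|c m p _ _ IH].
  by rewrite mul0r pihomog0.
rewrite mulrDl pihomogD IH addr0 -scalerAl linearZ /=.
have hm : 'X_[m] * h \is (mdeg m + k).-homog.
  by apply: dhomogM => //; rewrite dhomogX.
rewrite (pihomog_ne0 _ hm) ?scaler0 // gtn_eqF //.
exact: leq_trans ltdk (leq_addl _ _).
Qed.


Lemma meval_homog d p c v :
  p \is d.-homog -> p.@[fun i => c * v i] = c ^+ d * p.@[v].
Proof.
move=> /dhomogP hp; rewrite !mevalE mulr_sumr !big_seq; apply: eq_bigr => m mp.
rewrite mulrCA; congr (_ * _); rewrite -(hp m mp) /= mdegE -prodrXr -big_split.
by apply: eq_bigr => i _; rewrite exprMn.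
Qed.

Lemma meval_line p c v :
  p.@[fun i => c * v i] = \sum_(d < msize p) c ^+ d * (hpart d p).@[v].
Proof.
rewrite {1}[p]hpart_sum raddf_sum; apply: eq_bigr => d _.
exact: meval_homog (pihomogP _ _ _).
Qed.

End HomogeneousParts.

(** * Homogeneous ideals *)

Section HomogeneousIdeals.
Variables (K : fieldType) (n : nat).
Local Notation R := {mpoly K[n]}.
Implicit Types (I P : set R) (p q h u : R) (v : 'I_n -> K).

(** Ideals are handled as predicates: all of those below are homogeneous, and
    the stability under [hpart] is what lets every membership be cut down to a
    single degree. *)
Record hideal I : Prop := Hideal {
  hideal0 : I 0;
  hidealD : forall p q, I p -> I q -> I (p + q);
  hidealM : forall u p, I p -> I (u * p);
  hideal_hpart : forall d p, I p -> I (hpart d p) }.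

Definition adjoin h I : set R := [set p | exists u, I (p - u * h)].

(** For a homogeneous ideal this says that it contains a power of the
    irrelevant ideal; one power of each variable is enough, which keeps the
    compactness arguments along chains of ideals finite. *)
Definition primary I : Prop := forall i : 'I_n, exists N, I ('X_i ^+ N).

Section One.
Variable I : set R.
Hypothesis hI : hideal I.

Lemma hidealZ c p : I p -> I (c *: p).
Proof. by rewrite -mul_mpolyC; apply: hidealM. Qed.

Lemma hidealN p : I p -> I (- p).
Proof. by rewrite -mulN1r; apply: hidealM. Qed.

Lemma hidealB p q : I p -> I q -> I (p - q).
Proof. by move=> Ip Iq; apply: hidealD => //; apply: hidealN. Qed.

Lemma hideal_sum (T : Type) (r : seq T) (Q : pred T) (F : T -> R) :
  (forall t, Q t -> I (F t)) -> I (\sum_(t <- r | Q t) F t).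
Proof.
by move=> IF; apply: big_ind => //; [exact: hideal0|exact: hidealD].
Qed.

Lemma hideal_of_hpart p : (forall d, I (hpart d p)) -> I p.
Proof. by move=> Ip; rewrite [p]hpart_sum; apply: hideal_sum. Qed.

Lemma hideal_cong p q : I (p - q) -> I q -> I p.
Proof. by move=> Ipq Iq; rewrite -(subrK q p); apply: hidealD. Qed.

Lemma hideal_congM p p' q q' :
  I (p - p') -> I (q - q') -> I (p * q - p' * q').
Proof.
move=> Ip Iq; have -> : p * q - p' * q' = q * (p - p') + p' * (q - q') by ring.
by apply: (hidealD hI); apply: (hidealM hI).
Qed.

Lemma hideal_congX p p' k : I (p - p') -> I (p ^+ k - p' ^+ k).
Proof.
move=> Ip; elim: k => [|k IH]; first by rewrite subrr; apply: hideal0.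
by rewrite !exprS; apply: hideal_congM.
Qed.

Lemma hideal_cong_prod (T : Type) (r : seq T) (F G : T -> R) :
  (forall t, I (F t - G t)) -> I (\prod_(t <- r) F t - \prod_(t <- r) G t).
Proof.
move=> IF; elim: r => [|t r IH]; first by rewrite !big_nil subrr; apply: hideal0.
by rewrite !big_cons; apply: hideal_congM.
Qed.

Lemma hideal_expn_le p j k : (j <= k)%N -> I (p ^+ j) -> I (p ^+ k).
Proof. by move=> /subnK <- Ip; rewrite exprD; apply: hidealM. Qed.

Lemma adjoin_sub h : I `<=` adjoin h I.
Proof. by move=> p Ip; exists 0; rewrite mul0r subr0. Qed.

Lemma adjoin_gen h : adjoin h I h.
Proof. by exists 1; rewrite mul1r subrr; apply: hideal0. Qed.

Lemma hideal_adjoin k h : h \is k.-homog -> hideal (adjoin h I).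
Proof.
move=> hh; split.
- by apply: adjoin_sub; apply: hideal0.
- move=> p q [u Iu] [w Iw]; exists (u + w).
  have -> : p + q - (u + w) * h = p - u * h + (q - w * h) by ring.
  exact: hidealD.
- move=> u p [w Iw]; exists (u * w); rewrite -mulrA -mulrBr; exact: hidealM.
- move=> d p [u Iu]; have [lkd|ltdk] := leqP k d.
    exists (hpart (d - k) u).
    by rewrite -(hpart_mul_ge _ hh lkd) -pihomogB; apply: hideal_hpart.
  exists 0; rewrite mul0r subr0 -[p](subrK (u * h)) pihomogD.
  by rewrite (hpart_mul_lt _ hh ltdk) addr0; apply: hideal_hpart.
Qed.

Lemma primary_monomials :
  primary I -> exists N, forall m : 'X_{1..n}, (N <= mdeg m)%N -> I 'X_[m].
Proof.
move=> /boolp.choice[N IN]; exists (\sum_i N i).+1 => m lem.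
have [i lei] : exists i, (N i <= m i)%N.
  apply/existsP; rewrite -[[exists _, _]]negbK negb_exists; apply/negP.
  move=> /forallP H; move: lem; rewrite ltnNge => /negP; apply.
  rewrite mdegE; apply: leq_sum => i _.
  by apply: ltnW; rewrite ltnNge; apply: H.
have -> : m = (m - U_(i) *+ N i + U_(i) *+ N i)%MM.
  rewrite submK //; apply/mnm_lepP => j; rewrite mulmnE mnm1E.
  by case: eqP => [<-|_]; rewrite ?mul1n.
by rewrite mpolyXD -mpolyXn; apply: hidealM.
Qed.

Lemma hideal_homog_ge N p d :
  (forall m : 'X_{1..n}, (N <= mdeg m)%N -> I 'X_[m]) ->
  (N <= d)%N -> p \is d.-homog -> I p.
Proof.
move=> IN led /dhomogP hp; rewrite [p]mpolyE big_seq; apply: hideal_sum => m mp.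
by apply: hidealZ; apply: IN; rewrite (hp m mp).
Qed.

End One.

Lemma lin_dep N D (b : 'I_D.+1 -> R) :
  #|{: 'X_{1..n < N.+1}}| = D -> (forall j, b j \is N.-homog) ->
  exists c : 'I_D.+1 -> K, (exists j, c j != 0) /\ \sum_j c j *: b j = 0.
Proof.
move=> cD hb.
pose M : 'M[K]_(D.+1, #|{: 'X_{1..n < N.+1}}|) :=
  \matrix_(j, t) (b j)@_(bmnm (enum_val t)).
have : kermx M != 0.
  rewrite kermx_eq0 /row_free ltn_eqF //.
  by apply: leq_ltn_trans (rank_leq_col M) _; rewrite cD.
case/rowV0Pn => c /sub_kermxP cM c0; exists (c 0); split.
  apply/existsP; rewrite -[[exists _, _]]negbK negb_exists; apply: contra c0.
  move=> /forallP H; apply/eqP/rowP => j; rewrite mxE.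
  by apply/eqP; have := H j; rewrite negbK.
apply/mpolyP => m; rewrite mcoeff0 raddf_sum /=.
have [ltm|lem] := ltnP (mdeg m) N.+1.
  have /rowP/(_ (enum_rank (Sub m ltm : 'X_{1..n < N.+1}))) := cM.
  rewrite !mxE => {2}<-; apply: eq_bigr => j _.
  by rewrite mcoeffZ mxE enum_rankK.
apply: big1 => j _; rewrite mcoeffZ (dhomog_nemf_coeff (hb j)) ?mulr0 //.
by rewrite gtn_eqF.
Qed.

(** Modulo I, any form of degree at least N is a multiple of h, so a form of
    degree N + j * k can be divided by h repeatedly until its degree is N. *)
Lemma adjoin_divide I h k N :
  hideal I -> h \is k.-homog ->
  (forall m : 'X_{1..n}, (N <= mdeg m)%N -> adjoin h I 'X_[m]) ->
  forall j p, p \is (N + j * k).-homog ->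
  exists2 b, b \is N.-homog & I (p - h ^+ j * b).
Proof.
move=> hI hh IN; elim=> [|j IH] p hp.
  exists p; first by rewrite -[N]addn0.
  by rewrite mul1r subrr; apply: hideal0.
have [u Iu] : adjoin h I p.
  exact: (hideal_homog_ge (hideal_adjoin hI hh) IN (leq_addr _ _) hp).
have le : (k <= N + j.+1 * k)%N by rewrite mulSn addnCA leq_addr.
have := hideal_hpart hI (N + j.+1 * k) Iu.
rewrite pihomogB (pihomog_dE hp) (hpart_mul_ge _ hh le).
have -> : (N + j.+1 * k - k = N + j * k)%N.
  by rewrite mulSn addnCA addKn.
move=> I1; have [b hb I2] := IH _ (pihomogP mdeg (N + j * k) u).
exists b => //; set w := hpart _ u in I1 I2.
have -> : p - h ^+ j.+1 * b = p - w * h + h * (w - h ^+ j * b).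
  by rewrite exprS; ring.
by apply: hidealD => //; apply: hidealM.
Qed.

(** By [adjoin_divide], modulo I the forms y^(N + jk) are multiples h^j b_j with
    all the b_j in the finite-dimensional space of forms of degree N.  Taking
    more of them than this dimension yields a linear relation between the b_j,
    hence a relation between y and h.  It plays the part of the integrality of y
    over K[h] modulo I. *)
Lemma algebraic_relation I h k y :
  hideal I -> h \is k.-homog -> primary (adjoin h I) -> y \is 1.-homog ->
  exists N D (q : {poly K}), [/\ q != 0, (size q <= D.+1)%N
    & I (y ^+ N * \sum_(j < D.+1) q`_j *: (y ^+ (k * j) * h ^+ (D - j)))].
Proof.
move=> hI hh /(primary_monomials (hideal_adjoin hI hh))[N IN] hy.
pose D := #|{: 'X_{1..n < N.+1}}|.
have /boolp.choice[b Hb] : forall j : 'I_D.+1, exists b,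
    b \is N.-homog /\ I (y ^+ (N + j * k) - h ^+ j * b).
  move=> j; have [|b hb Ib] := adjoin_divide hI hh IN (j := j) (p := y ^+ (N + j * k)).
    by have := dhomogMn (N + j * k) hy; rewrite mul1n.
  by exists b.
have [c [[j0 cj0] c0]] := lin_dep (erefl D) (fun j => (Hb j).1).
pose q := \poly_(j < D.+1) c (inord j).
have qE (j : 'I_D.+1) : q`_j = c j by rewrite coef_poly ltn_ord inord_val.
exists N, D, q; split.
- by apply/eqP => q0; move: cj0; rewrite -qE q0 coef0 eqxx.
- exact: size_poly.
have -> : y ^+ N * \sum_(j < D.+1) q`_j *: (y ^+ (k * j) * h ^+ (D - j)) =
  \sum_(j < D.+1) c j *: (h ^+ (D - j) * (y ^+ (N + j * k) - h ^+ j * b j))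
    + h ^+ D * \sum_j c j *: b j.
  rewrite !mulr_sumr -big_split; apply: eq_bigr => j _ /=.
  rewrite qE -!scalerAr -scalerDr; congr (_ *: _).
  rewrite -[in X in _ + X * _](subnK (ltn_ord j : (j <= D)%N)) !exprD (mulnC j).
  ring.
rewrite c0 mulr0 addr0; apply: hideal_sum => // j _.
by apply: hidealZ => //; apply: hidealM => //; apply: (Hb j).2.
Qed.

End HomogeneousIdeals.

(** * Maximal homogeneous ideals *)

Section Chains.
Variables (K : fieldType) (n : nat).
Local Notation R := {mpoly K[n]}.
Implicit Types (I P : set R) (F : set (set R)).

Lemma chain_finite (T : eqType) (G : set R -> T -> Prop) F (s : seq T) :
  (forall I P t, I `<=` P -> G I t -> G P t) ->
  F !=set0 -> total_on F subset ->
  (forall t, t \in s -> exists2 I, F I & G I t) ->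
  exists2 I, F I & forall t, t \in s -> G I t.
Proof.
move=> mG [I0 FI0] totF; elim: s => [|t s IH] H; first by exists I0.
have [I1 FI1 G1] := H t (mem_head _ _).
have [t' t's|I2 FI2 G2] := IH; first by apply: H; rewrite inE t's orbT.
have [le|le] := totF _ _ FI1 FI2.
  exists I2 => // t'; rewrite inE => /orP[/eqP->|]; first exact: mG le G1.
  exact: G2.
exists I1 => // t'; rewrite inE => /orP[/eqP->//|/G2]; exact: mG.
Qed.

Lemma hideal_chain F : F !=set0 -> total_on F subset ->
  (forall I, F I -> hideal I) -> hideal (\bigcup_(I in F) I).
Proof.
move=> F0 totF hF; have [I0 FI0] := F0; split.
- by exists I0 => //; exact: hideal0 (hF _ FI0).
- move=> p q [I FI Ip] [J FJ Jq]; have [le|le] := totF _ _ FI FJ.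
    by exists J => //; apply: (hidealD (hF _ FJ)) => //; apply: le.
  by exists I => //; apply: (hidealD (hF _ FI)) => //; apply: le.
- by move=> u p [I FI Ip]; exists I => //; apply: (hidealM (hF _ FI)).
- by move=> d p [I FI Ip]; exists I => //; apply: (hideal_hpart (hF _ FI)).
Qed.

(** Zorn's lemma above I, the predicate being applied to the sets I `|` X so
    that the empty chain needs no separate bound. *)
Lemma hideal_Zorn (Q : set (set R)) I : hideal I -> Q I ->
  (forall F, F !=set0 -> total_on F subset ->
     (forall J, F J -> hideal J /\ Q J) -> Q (\bigcup_(J in F) J)) ->
  exists P, [/\ hideal P, I `<=` P, Q P
    & forall P', hideal P' -> P `<=` P' -> Q P' -> P' `<=` P].
Proof.
move=> hI QI chQ.
have [|A [[hA QA] maxA]] :=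
    @Zorn_bigcup R [set X | hideal (I `|` X) /\ Q (I `|` X)].
  move=> F FQ totF /=; have [F0|/set0P/negP/negPn/eqP->] := pselect (F !=set0); last first.
    by rewrite bigcup_set0 setU0.
  (* the chain of ideals that correspond to the sets in F *)
  pose F' := [set I `|` X | X in F].
  have -> : I `|` \bigcup_(X in F) X = \bigcup_(X in F') X.
    apply/seteqP; split=> p.
      case=> [Ip|[X FX Xp]].
        by have [X FX] := F0; exists (I `|` X); [exists X|left].
      by exists (I `|` X); [exists X|right].
    by case=> _ [X FX <-] [Ip|Xp]; [left|right; exists X].
  have F'0 : F' !=set0 by have [X FX] := F0; exists (I `|` X); exists X.
  have totF' : total_on F' subset.
    move=> _ _ [X FX <-] [Y FY <-].
    by have [le|le] := totF _ _ FX FY; [left|right]; apply: setUS.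
  have F'Q J : F' J -> hideal J /\ Q J by move=> [X /FQ[hX QX] <-].
  by split; [apply: hideal_chain => // J /F'Q[]|apply: chQ].
exists (I `|` A); split=> // P' hP' leP' QP' p P'p; right.
have [//|nAp] := pselect (A p); exfalso.
have IP' : I `|` P' = P' by apply/setUidPr => q Iq; apply: leP'; left.
apply: (maxA P'); last by split; rewrite IP'.
by split; [move=> q Aq; apply: leP'; right|move=> /(_ p P'p)].
Qed.

Lemma primary_chain F : F !=set0 -> total_on F subset ->
  primary (\bigcup_(I in F) I) -> exists2 I, F I & primary I.
Proof.
move=> F0 totF prU.
have [||J FJ HJ] := chain_finite
    (G := fun J (i : 'I_n) => exists N, J ('X_i ^+ N)) (s := enum 'I_n) _ F0 totF.
- by move=> J P i le [N JN]; exists N; apply: le.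
- by move=> i _; have [N [J FJ JN]] := prU i; exists J => //; exists N.
by exists J => // i; apply: HJ; rewrite mem_enum.
Qed.

End Chains.

(** * The projective Nullstellensatz *)

Section Nullstellensatz.
Variables (K : closedFieldType) (n : nat).
Local Notation R := {mpoly K[n]}.
Implicit Types (I P : set R).

Definition hprime P : Prop := forall d e a b,
  a \is d.-homog -> b \is e.-homog -> P (a * b) -> P a \/ P b.

(** Over an algebraically closed field the binary form in y and z
    with coefficients q splits into linear factors, one of which lies in the
    prime P; the factor z cannot, which is why it can be cancelled when q has
    smaller degree than the form. *)
Lemma binary_form_factor P (y z : R) D (q : {poly K}) :
  hideal P -> hprime P -> y \is 1.-homog -> z \is 1.-homog -> ~ P z ->
  q != 0 -> (size q <= D.+1)%N ->
  P (\sum_(j < D.+1) q`_j *: (y ^+ j * z ^+ (D - j))) ->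
  exists c, P (y - c *: z).
Proof.
move=> hP prP hy hz nPz.
have hform E (p : {poly K}) :
    (\sum_(j < E.+1) p`_j *: (y ^+ j * z ^+ (E - j))) \is E.-homog.
  apply: rpred_sum => j _; apply: rpredZ.
  have := dhomogM (dhomogMn j hy) (dhomogMn (E - j) hz).
  by rewrite !mul1n subnKC // -ltnS.
elim: D q => [|D IH] q q0 sq.
  rewrite big_ord1 mulr1 => Pc; case: nPz.
  have q00 : q`_0 != 0.
    by apply: contra q0 => /eqP q00; rewrite (size1_polyC sq) q00.
  have -> : z = (q`_0)^-1 *: (z * (q`_0 *: 1)).
    by rewrite -scalerAr mulr1 scalerA mulVf // scale1r.
  by apply: (hidealZ hP); apply: (hidealM hP).
have [le|gt] := leqP (size q) D.+1.
  rewrite big_ord_recr /= [q`_D.+1]nth_default // scale0r addr0.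
  have -> : \sum_(i < D.+1) q`_i *: (y ^+ i * z ^+ (D.+1 - i)) =
      z * \sum_(i < D.+1) q`_i *: (y ^+ i * z ^+ (D - i)).
    rewrite mulr_sumr; apply: eq_bigr => i _.
    rewrite -scalerAr subSn ?exprS; last by rewrite -ltnS.
    by rewrite mulrCA.
  by case/(prP _ _ _ _ hz (hform D q)) => // /IH; apply.
have sqE : size q = D.+2 by apply/eqP; rewrite eqn_leq sq.
have [r /factor_theorem[q' qE]] : exists r, root q r.
  by apply/closed_rootP; rewrite sqE.
have q'0 : q' != 0 by apply: contra q0 => /eqP q'0; rewrite qE q'0 mul0r.
have sq' : size q' = D.+1.
  by have := sqE; rewrite qE size_Mmonic ?monicXsubC // size_XsubC addn2 => -[].
have -> : \sum_(i < D.+2) q`_i *: (y ^+ i * z ^+ (D.+1 - i)) =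
    (y - r *: z) * \sum_(i < D.+1) q'`_i *: (y ^+ i * z ^+ (D - i)).
  have cE j : q`_j = (if j == 0%N then 0 else q'`_j.-1) - q'`_j * r.
    by rewrite qE mulrBr coefB coefMX coefMC.
  transitivity (\sum_(i < D.+2)
      ((if i == 0%N :> nat then 0 else q'`_i.-1) *: (y ^+ i * z ^+ (D.+1 - i))
        - (q'`_i * r) *: (y ^+ i * z ^+ (D.+1 - i)))).
    by apply: eq_bigr => i _; rewrite cE scalerBl.
  rewrite sumrB mulrBl big_ord_recl /= scale0r add0r; congr (_ - _).
    rewrite mulr_sumr; apply: eq_bigr => i _.
    by rewrite -scalerAr exprS mulrA.
  rewrite big_ord_recr /= [q'`_D.+1]nth_default ?sq' // mul0r scale0r addr0.
  rewrite mulr_sumr; apply: eq_bigr => i _.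
  rewrite -scalerAr -scalerAl scalerA; congr (_ *: _).
  rewrite subSn ?exprS; last by rewrite -ltnS.
  by rewrite mulrCA.
have hyr : y - r *: z \is 1.-homog by rewrite rpredB // rpredZ.
case/(prP _ _ _ _ hyr (hform D q')) => [Pr|]; first by exists r.
by apply: IH => //; rewrite sq'.
Qed.

(** The product of (P, a) and (P, b) is contained in P. *)
Lemma primary_adjoinM P d e a b : hideal P ->
  a \is d.-homog -> b \is e.-homog -> P (a * b) ->
  primary (adjoin a P) -> primary (adjoin b P) -> primary P.
Proof.
move=> hP ha hb Pab pra prb i.
have [[j [u Pu]] [k [w Pw]]] := (pra i, prb i).
exists (j + k)%N; rewrite exprD; set x := 'X_i in Pu Pw *.
have -> : x ^+ j * x ^+ k = x ^+ j * (x ^+ k - w * b)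
    + w * b * (x ^+ j - u * a) + u * w * (a * b) by ring.
by apply: (hidealD hP); [apply: (hidealD hP)|]; apply: (hidealM hP).
Qed.

(** Let P be maximal among the homogeneous ideals above I that contain no power
    of the irrelevant ideal.  It is prime and misses some variable x_0, and
    (P, x_0) contains a power of the irrelevant ideal, so that
    [algebraic_relation] gives a binary form in x_i and x_0 lying in P.  One of
    its linear factors x_i - v_i x_0 is in P.  Then every form of degree d is
    congruent modulo P to its value at v times x_0^d, so v is a zero of P,
    hence of I; as x_0 is not in P, v is not 0. *)
Lemma Nullstellensatz I : hideal I ->
  (forall v, zero_locus I v -> v = fun=> 0) -> primary I.
Proof.
move=> hI V0; apply: contrapT => nprI.
have [|P [hP IP nprP maxP]] := hideal_Zorn (Q := fun P => ~ primary P) hI nprI.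
  move=> F F0 totF FQ /(primary_chain F0 totF)[J FJ].
  exact: (FQ _ FJ).2.
have prim_adj d (a : R) : a \is d.-homog -> ~ P a -> primary (adjoin a P).
  move=> ha nPa; apply: contrapT => npr; apply: nPa.
  apply: (maxP _ (hideal_adjoin hP ha) _ npr); last exact: adjoin_gen.
  exact: adjoin_sub.
have prP : hprime P.
  move=> d e a b ha hb Pab; apply: contrapT => /not_orP[na nb].
  apply: nprP; exact: (primary_adjoinM hP ha hb Pab (prim_adj _ _ ha na)
    (prim_adj _ _ hb nb)).
have hX (i : 'I_n) : ('X_i : R) \is 1.-homog by rewrite dhomogX /= mdeg1.
have [i0 nPi0] : exists i0 : 'I_n, ~ P 'X_i0.
  apply/existsNP => H; apply: nprP => i; exists 1%N; exact: H.
have P1 p k : p \is 1.-homog -> P (p ^+ k) -> P p.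
  move=> hp; elim: k => [|k IH].
    by move=> P1; rewrite -[p]mulr1; apply: (hidealM hP).
  rewrite exprS => /(prP _ _ _ _ hp (dhomogMn k hp))[]//.
have /boolp.choice[v Hv] : forall i : 'I_n, exists c : K, P ('X_i - c *: 'X_i0).
  move=> i.
  have [N [D [q [q0 sq]]]] :=
    algebraic_relation hP (hX i0) (prim_adj _ _ (hX i0) nPi0) (hX i).
  under eq_bigr => j _ do rewrite mul1n.
  have hform : (\sum_(j < D.+1) q`_j *: ('X_i ^+ j * 'X_i0 ^+ (D - j)) : R)
      \is D.-homog.
    apply: rpred_sum => j _; apply: rpredZ.
    have := dhomogM (dhomogMn j (hX i)) (dhomogMn (D - j) (hX i0)).
    by rewrite !mul1n subnKC // -ltnS.
  case/(prP _ _ _ _ (dhomogMn N (hX i)) hform).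
    by move/(P1 _ _ (hX i)) => Pi; exists 0; rewrite scale0r subr0.
  exact: binary_form_factor.
pose z : R := 'X_i0.
have cong_mon m : P ('X_[m] - (\prod_i v i ^+ m i) *: z ^+ mdeg m).
  have -> : (\prod_i v i ^+ m i) *: z ^+ mdeg m = \prod_i (v i *: z) ^+ m i.
    rewrite mdegE -prodrXr -scaler_prod.
    by apply: eq_bigr => i _; rewrite exprZn.
  rewrite mpolyXE_id; apply: (hideal_cong_prod hP) => i.
  exact: (hideal_congX hP).
have cong d p : p \is d.-homog -> P (p - p.@[v] *: z ^+ d).
  move=> /dhomogP hp; rewrite mevalE scaler_suml {1}[p]mpolyE -sumrB big_seq.
  apply: (hideal_sum hP) => m mp; rewrite -scalerA -scalerBr.
  by apply: (hidealZ hP); rewrite -(hp m mp); apply: cong_mon.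
have : v = fun=> 0.
  apply: V0 => p Ip; rewrite [p]hpart_sum raddf_sum big1 // => d _.
  have Pd : P (hpart d p) by apply: IP; apply: hideal_hpart.
  apply/eqP; apply/negPn/negP => /negP nz; apply: nPi0; apply: (P1 _ d (hX i0)).
  have hd := pihomogP mdeg d p.
  set c := (hpart d p).@[v] in nz.
  have -> : 'X_i0 ^+ d = c^-1 *: (hpart d p - (hpart d p - c *: z ^+ d)).
    by rewrite subKr scalerA mulVf ?scale1r //; apply/negP.
  apply: (hidealZ hP); apply: (hidealB hP) => //; exact: cong.
move=> v0; apply: nPi0; have := Hv i0.
by rewrite v0 scale0r subr0.
Qed.

End Nullstellensatz.

(** * Cones of dimension at most one *)

Section Cones.
Variables (K : closedFieldType) (n : nat).
Local Notation R := {mpoly K[n]}.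
Implicit Types (I P : set R) (v : 'I_n -> K).

Lemma zero_locus_cone I c v :
  hideal I -> zero_locus I v -> zero_locus I (fun i => c * v i).
Proof.
move=> hI Iv p Ip; rewrite meval_line big1 // => d _.
by rewrite (Iv _ (hideal_hpart hI d Ip)) mulr0.
Qed.

Lemma zero_locus_adjoin h I v :
  I 0 -> zero_locus (adjoin h I) v <-> zero_locus I v /\ h.@[v] = 0.
Proof.
move=> I0; split=> [H|[H hv] p [u Iu]].
  split=> [p Ip|]; apply: H; first by exists 0; rewrite mul0r subr0.
  by exists 1; rewrite mul1r subrr.
by have := H _ Iu; rewrite mevalB mevalM hv mulr0 subr0.
Qed.

Lemma primary_zero I v : primary I -> zero_locus I v -> v = fun=> 0.
Proof.
move=> prI Iv; apply/funext => i; have [N IN] := prI i.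
have := Iv _ IN; rewrite rmorphXn /= mevalXU => /eqP; rewrite expf_eq0.
by case/andP => _ /eqP.
Qed.

Lemma exists_root_of k (c : K) : (0 < k)%N -> exists a, a ^+ k = c.
Proof.
move=> k0; have /closed_rootP[a] : size ('X^k - c%:P) != 1%N.
  by rewrite size_XnsubC //; case: k k0.
by rewrite /root !hornerE subr_eq0 => /eqP aE; exists a.
Qed.

(** This is how finiteness statements on the affine section h = 1 become
    statements on lines of the cone. *)
Lemma rescale I h k v : hideal I -> h \is k.-homog -> (0 < k)%N ->
  zero_locus I v -> h.@[v] != 0 ->
  exists a, [/\ a != 0, zero_locus I (fun i => a * v i)
              & h.@[fun i => a * v i] = 1].
Proof.
move=> hI hh k0 Iv hv; have [a aE] := exists_root_of (h.@[v])^-1 k0.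
exists a; split; last 1 first.
- by rewrite (meval_homog _ _ hh) aE mulVf.
- apply/eqP => a0; move: aE; rewrite a0 expr0n (gtn_eqF k0) => /esym/eqP.
  by rewrite invr_eq0 (negPf hv).
- exact: zero_locus_cone.
Qed.

(** Each coordinate of a point with h = 1 is a root of the fixed nonzero
    univariate polynomial supplied by [algebraic_relation]. *)
Lemma finite_section I h k :
  hideal I -> h \is k.-homog -> (0 < k)%N -> primary (adjoin h I) ->
  exists (T : finType) (w : T -> 'I_n -> K),
    forall v, zero_locus I v -> h.@[v] = 1 -> exists t, v = w t.
Proof.
move=> hI hh k0 prI.
have /boolp.choice[q Hq] : forall i : 'I_n, exists q : {poly K}, q != 0 /\
    forall v, zero_locus I v -> h.@[v] = 1 -> root q (v i).
  move=> i; have hX : ('X_i : R) \is 1.-homog by rewrite dhomogX /= mdeg1.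
  have [N [D [q [q0 sq Iq]]]] := algebraic_relation hI hh prI hX.
  exists ('X^N * (q \Po 'X^k)); split.
    apply: mulf_neq0; first exact: monic_neq0 (monicXn _ _).
    by rewrite comp_poly_eq0 // size_polyXn ltnS.
  move=> v Iv hv; have := Iv _ Iq.
  rewrite mevalM rmorphXn /= mevalXU raddf_sum => E.
  rewrite /root hornerM hornerXn horner_comp hornerXn (horner_coef_wide _ sq).
  apply/eqP; rewrite -[RHS]E; congr (_ * _); apply: eq_bigr => j _.
  by rewrite /= mevalZ mevalM !rmorphXn /= mevalXU hv expr1n mulr1 exprM.
have /boolp.choice[r Hr] : forall i : 'I_n, exists r : seq K,
    forall v, zero_locus I v -> h.@[v] = 1 -> v i \in r.
  move=> i; have [r qr] := closed_field_poly_normal (q i).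
  exists r => v Iv hv; have := (Hq i).2 v Iv hv.
  rewrite qr rootZ ?lead_coef_eq0 ?(Hq i).1 //.
  by rewrite root_prod_XsubC.
pose B := \max_i size (r i).
exists {ffun 'I_n -> 'I_B.+1},
  (fun (t : {ffun 'I_n -> 'I_B.+1}) i => nth 0 (r i) (t i)) => v Iv hv.
exists [ffun i => inord (index (v i) (r i))]; apply/funext => i.
have vr := Hr i v Iv hv.
rewrite ffunE inordK ?nth_index // ltnS.
by apply: leq_trans (leq_bigmax i); apply: index_size.
Qed.

(** The generic combinations p_0 + s p_1 + s^2 p_2 + ... depend on a single
    parameter, so genericity is the choice of a non-root of one polynomial
    in s. *)
Fixpoint comb (s : K) (F : seq R) : R :=
  if F is p :: F' then p + s *: comb s F' else 0.

Lemma comb_homog e s F : {in F, forall p, p \is e.-homog} -> comb s F \is e.-homog.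
Proof.
elim: F => [|p F IH] hF /=; first exact: rpred0.
apply: rpredD; first by apply: hF; exact: mem_head.
by apply: rpredZ; apply: IH => q qF; apply: hF; rewrite inE qF orbT.
Qed.

Lemma comb_avoid (T : finType) (w : T -> 'I_n -> K) (F : seq R) :
  exists s, forall t,
    (exists2 p, p \in F & p.@[w t] != 0) -> (comb s F).@[w t] != 0.
Proof.
pose q t := Poly [seq p.@[w t] | p <- F].
have qE s t : (q t).[s] = (comb s F).@[w t].
  rewrite horner_Poly; elim: F {q} => [|p F IH] /=; first by rewrite meval0.
  by rewrite IH mevalD mevalZ addrC mulrC.
have : \prod_(t | q t != 0) q t != 0 by apply/prodf_neq0.
move=> /closed_nonrootP[s ns]; exists s => t [p pF pt]; rewrite -qE.
have qt : q t != 0.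
  apply/eqP => /(congr1 (fun Q : {poly K} => Q`_(index p F))); rewrite coef0.
  rewrite coef_Poly (nth_map 0) ?index_mem // nth_index //; exact/eqP.
by move: ns; rewrite /root (bigD1 t) //= hornerM mulf_eq0 negb_or => /andP[].
Qed.

(** The hypothesis on h says that I defines finitely many lines; a generic
    combination of the F vanishes on none of them, because the F
    have no common zero there. *)
Lemma generic_combination I h k e (F : seq R) :
  hideal I -> h \is k.-homog -> (0 < k)%N -> primary (adjoin h I) ->
  {in F, forall p, p \is e.-homog} ->
  (forall v, zero_locus I v -> (forall p, p \in F -> p.@[v] = 0) ->
     v = fun=> 0) ->
  exists s, primary (adjoin (comb s F) I).
Proof.
move=> hI hh k0 prI hF VF.
have [T [w Hw]] := finite_section hI hh k0 prI.
have [s Hs] := comb_avoid w F; exists s.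
have hc := comb_homog s hF.
apply: Nullstellensatz => [|v]; first exact: hideal_adjoin hc.
move=> /(zero_locus_adjoin _ _ (hideal0 hI))[Iv cv].
have [hv|hv] := eqVneq h.@[v] 0.
  by apply: (primary_zero prI); apply/(zero_locus_adjoin _ _ (hideal0 hI)).
have [a [a0 Iav hav]] := rescale hI hh k0 Iv hv.
have [t avE] := Hw _ Iav hav.
have [H|/existsNP[p /not_implyP[pF /eqP pt]]] :=
  pselect (forall p, p \in F -> p.@[w t] = 0).
  apply: VF => // p pF; have := H p pF.
  rewrite -avE (meval_homog _ _ (hF p pF)) => /eqP.
  by rewrite mulf_eq0 expf_eq0 (negPf a0) andbF => /eqP.
have : (comb s F).@[w t] != 0 by apply: Hs; exists p.
by rewrite -avE (meval_homog _ _ hc) cv mulr0 eqxx.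
Qed.

Definition finite_lines I : Prop :=
  exists (T : finType) (w : T -> 'I_n -> K), forall v, zero_locus I v ->
    exists t c, v = fun i => c * w t i.

Definition vars : seq R := [seq 'X_i | i <- enum 'I_n].

Lemma vars_homog : {in vars, forall p, p \is 1.-homog}.
Proof. by move=> _ /mapP[i _ ->]; rewrite dhomogX /= mdeg1. Qed.

Lemma vars_zero v : (forall p, p \in vars -> p.@[v] = 0) -> v = fun=> 0.
Proof.
move=> H; apply/funext => i; rewrite -(mevalXU v i); apply: H.
by apply/mapP; exists i; rewrite ?mem_enum.
Qed.

Lemma finite_lines_section I : hideal I -> finite_lines I ->
  exists s, primary (adjoin (comb s vars) I).
Proof.
move=> hI [T [w Hw]]; have [s Hs] := comb_avoid w vars; exists s.
have hc := comb_homog s vars_homog.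
apply: Nullstellensatz => [|v]; first exact: hideal_adjoin hc.
move=> /(zero_locus_adjoin _ _ (hideal0 hI))[/Hw[t [c vE]] cv].
have [H|/existsNP[p /not_implyP[pF /eqP pt]]] :=
  pselect (forall p, p \in vars -> p.@[w t] = 0).
  by rewrite vE (vars_zero H); apply/funext => i; rewrite mulr0.
have ct : (comb s vars).@[w t] != 0 by apply: Hs; exists p.
have := cv; rewrite vE (meval_homog _ _ hc) expr1 => /eqP.
rewrite mulf_eq0 (negPf ct) orbF => /eqP->.
by apply/funext => i; rewrite mul0r.
Qed.

Lemma section_finite_lines I h k :
  hideal I -> h \is k.-homog -> (0 < k)%N -> primary (adjoin h I) ->
  finite_lines I.
Proof.
move=> hI hh k0 prI; have [T [w Hw]] := finite_section hI hh k0 prI.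
(* None stands for the origin, in case T is empty *)
exists (option T), (fun t => if t is Some t' then w t' else fun=> 0) => v Iv.
have [hv|hv] := eqVneq h.@[v] 0.
  exists None, 0; rewrite (primary_zero (v := v) prI).
    by apply/funext => i; rewrite mulr0.
  by apply/(zero_locus_adjoin _ _ (hideal0 hI)).
have [a [a0 Iav hav]] := rescale hI hh k0 Iv hv.
have [t avE] := Hw _ Iav hav; exists (Some t), a^-1; apply/funext => i.
by rewrite -avE mulrA mulVf // mul1r.
Qed.

(** Compactness: being a finite union of lines is witnessed by a linear form
    together with finitely many memberships, which all hold in a single ideal of
    the chain. *)
Lemma finite_lines_chain (F : set (set R)) : F !=set0 -> total_on F subset ->
  (forall I, F I -> hideal I) -> finite_lines (\bigcup_(I in F) I) ->
  exists2 I, F I & finite_lines I.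
Proof.
move=> F0 totF hF /(finite_lines_section (hideal_chain F0 totF hF))[s prU].
set l := comb s vars in prU.
have [||J FJ HJ] := chain_finite
    (G := fun J (i : 'I_n) => exists N, adjoin l J ('X_i ^+ N))
    (s := enum 'I_n) _ F0 totF.
- by move=> J P i le [N [u JN]]; exists N, u; apply: le.
- by move=> i _; have [N [u [J FJ JN]]] := prU i; exists J => //; exists N, u.
exists J => //; have hl := comb_homog s vars_homog.
apply: (section_finite_lines (hF _ FJ) hl) => // i.
by apply: HJ; rewrite mem_enum.
Qed.

Lemma finite_linesM P a b : P 0 ->
  (forall v, zero_locus P v -> a.@[v] * b.@[v] = 0) ->
  finite_lines (adjoin a P) -> finite_lines (adjoin b P) -> finite_lines P.
Proof.
move=> P0 Pab [T1 [w1 H1]] [T2 [w2 H2]].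
exists (T1 + T2)%type, (fun t => match t with inl t => w1 t | inr t => w2 t end).
move=> v Pv; have /eqP := Pab v Pv; rewrite mulf_eq0 => /orP[]/eqP pv.
  have [|t [c vE]] := H1 v; first exact/(zero_locus_adjoin _ _ P0).
  by exists (inl t), c.
have [|t [c vE]] := H2 v; first exact/(zero_locus_adjoin _ _ P0).
by exists (inr t), c.
Qed.

Definition on_line (p : R) v : {poly K} := \poly_(d < msize p) (hpart d p).@[v].

Lemma on_lineE p v c : (on_line p v).[c] = p.@[fun i => c * v i].
Proof.
by rewrite horner_poly meval_line; apply: eq_bigr => d _; rewrite mulrC.
Qed.

Lemma line_irreducible v :
  zariski_irreducible [set u | exists c, u = fun i => c * v i].
Proof.
split; first by exists (fun i => 0 * v i), 0.
move=> _ _ [P1 ->] [P2 ->] H; apply: contrapT => /not_orP[].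
move=> /existsNP[_ /not_implyP[[c1 ->] /existsNP[p1 /not_implyP[Pp1 /eqP n1]]]].
move=> /existsNP[_ /not_implyP[[c2 ->] /existsNP[p2 /not_implyP[Pp2 /eqP n2]]]].
have : on_line p1 v * on_line p2 v != 0.
  apply: mulf_neq0; apply/eqP => E.
    by move: n1; rewrite -on_lineE E horner0 eqxx.
  by move: n2; rewrite -on_lineE E horner0 eqxx.
move=> /closed_nonrootP[c]; rewrite rootM negb_or /root !on_lineE.
move=> /andP[m1 m2].
have [|H1|H2] := H (fun i => c * v i); first by exists c.
  by rewrite (H1 _ Pp1) eqxx in m1.
by rewrite (H2 _ Pp2) eqxx in m2.
Qed.

Lemma line_closed v :
  zariski_closed [set u | exists c, u = fun i => c * v i].
Proof.
have [v0|/existsNP[i0 /eqP vi0]] := pselect (forall i, v i = 0).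
  exists [set p | exists i, p = 'X_i]; apply/seteqP; split=> u.
    by move=> [c ->] _ [i ->]; rewrite mevalXU v0 mulr0.
  move=> H; exists 0; apply/funext => i; rewrite mul0r -(mevalXU u i).
  by apply: H; exists i.
exists [set p | exists i, p = v i0 *: 'X_i - v i *: 'X_i0].
apply/seteqP; split=> u.
  by move=> [c ->] _ [i ->]; rewrite mevalB !mevalZ !mevalXU; ring.
move=> H; exists (u i0 / v i0); apply/funext => i.
have /eqP : (v i0 *: 'X_i - v i *: 'X_i0 : R).@[u] = 0 by apply: H; exists i.
rewrite mevalB !mevalZ !mevalXU subr_eq0 => /eqP E.
by apply: (mulfI vi0); rewrite E mulrA mulrCA mulfV // mulr1 mulrC.
Qed.

(** Suppose that V(P) is covered by two closed sets and contained in neither.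
    Restricting to lines through the origin shows that some forms a and b,
    neither vanishing on V(P), have a product vanishing there.  By maximality
    V(P, a) and V(P, b) are finite unions of lines, and V(P) is their union. *)
Lemma maximal_not_finite_lines_irreducible P : hideal P -> ~ finite_lines P ->
  (forall P', hideal P' -> P `<=` P' -> ~ finite_lines P' -> P' `<=` P) ->
  zariski_irreducible (zero_locus P).
Proof.
move=> hP nfP maxP.
have fl_adj d (a : R) v : a \is d.-homog -> zero_locus P v -> a.@[v] != 0 ->
    finite_lines (adjoin a P).
  move=> ha Pv av; apply: contrapT => nf.
  have : P a.
    apply: (maxP _ (hideal_adjoin hP ha) _ nf); last exact: adjoin_gen.
    exact: adjoin_sub.
  by move/Pv/eqP; rewrite (negPf av).
split.
  have [//|V0] := pselect (zero_locus P !=set0); case: nfP.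
  exists unit, (fun _ _ => 0) => v Pv; case: V0; by exists v.
have hpart_nz (p : R) v : p.@[v] != 0 -> exists d : 'I_(msize p), (hpart d p).@[v] != 0.
  move=> pv; apply/existsP; rewrite -[[exists _, _]]negbK negb_exists.
  apply: contra pv => /forallP H; rewrite {1}[p]hpart_sum raddf_sum big1 // => d _.
  by apply/eqP; have := H d; rewrite negbK.
move=> _ _ [P1 ->] [P2 ->] H; apply: contrapT => /not_orP[].
move=> /existsNP[v1 /not_implyP[V1 /existsNP[p1 /not_implyP[Pp1 /eqP n1]]]].
move=> /existsNP[v2 /not_implyP[V2 /existsNP[p2 /not_implyP[Pp2 /eqP n2]]]].
have [[d1 m1] [d2 m2]] := (hpart_nz _ _ n1, hpart_nz _ _ n2).
apply: nfP; apply: (finite_linesM (hideal0 hP) _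
  (fl_adj _ _ _ (pihomogP mdeg d1 p1) V1 m1)
  (fl_adj _ _ _ (pihomogP mdeg d2 p2) V2 m2)) => v Pv.
have : on_line p1 v * on_line p2 v = 0.
  apply/eqP; apply: contraT => /closed_nonrootP[c].
  rewrite rootM negb_or /root !on_lineE => /andP[k1 k2].
  have [H1|H2] := H _ (zero_locus_cone c hP Pv).
    by rewrite (H1 _ Pp1) eqxx in k1.
  by rewrite (H2 _ Pp2) eqxx in k2.
have cE (p : R) (d : 'I_(msize p)) : (on_line p v)`_d = (hpart d p).@[v].
  by rewrite coef_poly ltn_ord.
move=> /eqP; rewrite mulf_eq0 -(cE p1) -(cE p2).
by case/orP => /eqP ->; rewrite coef0 ?mul0r ?mulr0.
Qed.

(** Otherwise a homogeneous ideal P above I, maximal among those whose zero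
    locus is not a finite union of lines, has an irreducible zero locus; for
    any v <> 0 in it, {0}, K v and V(P) form a chain of irreducible closed sets
    that is too long. *)
Lemma dim_le1_finite_lines I : hideal I -> dim_le (zero_locus I) 1 ->
  finite_lines I.
Proof.
move=> hI dimI; apply: contrapT => nfI.
have [|P [hP IP nfP maxP]] := hideal_Zorn (Q := fun P => ~ finite_lines P) hI nfI.
  move=> F F0 totF FQ /(finite_lines_chain F0 totF)[|J FJ].
    by move=> J /FQ[].
  exact: (FQ _ FJ).2.
have irrP := maximal_not_finite_lines_irreducible hP nfP maxP.
have [v [Pv v0]] : exists v, zero_locus P v /\ v <> fun=> 0.
  apply: contrapT => /forallNP H; apply: nfP.
  exists unit, (fun _ _ => 0) => v Pv; exists tt, 0.
  have [->|v0] := pselect (v = fun=> 0); first by apply/funext => i; rewrite mul0r.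
  by case: (H v).
pose line u := [set x : 'I_n -> K | exists c, x = fun i => c * u i].
have lineP : line v `<=` zero_locus P by move=> _ [c ->]; apply: zero_locus_cone.
(* the chain {0}, K v, V(P) *)
suff : (2 <= 1)%N by [].
apply: (dimI 2%N (fun i => if i is i'.+1 then
  (if i' is 0 then line v else zero_locus P) else line (fun=> 0))) => [[|[|i]] _|[|[|i]] // _].
- split; [exact: line_closed|exact: line_irreducible|].
  move=> _ [c ->] p /IP Pp; have := lineP (fun i => 0 * v i).
  move=> /(_ (ex_intro _ 0 erefl) p Pp) E; rewrite -[RHS]E; apply: meval_eq => i.
  by rewrite /= mul0r mulr0.
- split; [exact: line_closed|exact: line_irreducible|].
  by move=> u /lineP Pu p /IP; apply: Pu.
- split => //; first by exists P.
  by move=> u Pu p /IP; apply: Pu.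
- split=> [_ [c ->]|]; first by exists 0; apply/funext => i; rewrite mulr0 mul0r.
  move=> /(_ v); case=> [|c vE]; last first.
    by apply: v0; rewrite vE; apply/funext => i; rewrite mulr0.
  by exists 1; apply/funext => i; rewrite mul1r.
- split=> // H; apply: nfP; exists unit, (fun=> v) => u /H[c uE].
  by exists tt, c.
Qed.

End Cones.

(** * Regular sequences and Gorenstein quotients *)

Section Regular.
Variables (K : fieldType) (n : nat).
Local Notation R := {mpoly K[n]}.
Implicit Types (I P : set R) (s t X G : seq R) (x y z g a b c u : R).

(** A degree bound from below is what makes the graded Nakayama argument of
    [nzd_swap1] terminate. *)
Definition form p : Prop := exists2 e, (0 < e)%N & (p : R) \is e.-homog.
Definition forms s : Prop := {in s, forall p, form p}.

Lemma forms_cons h s : forms (h :: s) -> form h /\ forms s.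
Proof.
move=> H; split; first by apply: H; exact: mem_head.
by move=> p ps; apply: H; rewrite inE ps orbT.
Qed.

Lemma formsC h s : form h -> forms s -> forms (h :: s).
Proof. by move=> hh hs p; rewrite inE => /orP[/eqP->//|/hs]. Qed.

Lemma forms_cat s t : forms s -> forms t -> forms (s ++ t).
Proof. by move=> hs ht p; rewrite mem_cat => /orP[/hs|/ht]. Qed.

Fixpoint idl s : set R := if s is h :: s' then adjoin h (idl s') else [set 0].

Lemma hideal_set0 : hideal [set (0 : R)].
Proof.
split=> // [p q -> ->|u p ->|d p ->]; first by rewrite addr0.
  by rewrite mulr0.
by rewrite pihomog0.
Qed.

Lemma hideal_idl s : forms s -> hideal (idl s).
Proof.
elim: s => [|h s IH] /=; first by move=> _; apply: hideal_set0.
by case/forms_cons => -[e _ hh] /IH hs; exact: (hideal_adjoin hs hh).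
Qed.

Lemma idl_mem s p : forms s -> p \in s -> idl s p.
Proof.
elim: s => [//|h s IH] /forms_cons[_ hs]; rewrite inE => /orP[/eqP->|ps] /=.
  exact: (adjoin_gen (hideal_idl hs)).
by apply: adjoin_sub; apply: IH.
Qed.

Lemma idl_sub s I : I 0 -> (forall p q, I p -> I q -> I (p + q)) ->
  (forall u p, I p -> I (u * p)) -> {in s, forall p, I p} -> idl s `<=` I.
Proof.
move=> I0 ID IM; elim: s => [|h s IH] Is p /=; first by move=> ->.
case=> u up; rewrite -(subrK (u * h) p); apply: ID.
  by apply: IH up => q qs; apply: Is; rewrite inE qs orbT.
by apply: IM; apply: Is; exact: mem_head.
Qed.

Lemma idl_subset s t : forms t -> {in s, forall p, idl t p} ->
  idl s `<=` idl t.
Proof.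
move=> ht; have hI := hideal_idl ht; apply: idl_sub; first exact: hideal0.
  exact: (hidealD hI).
exact: (hidealM hI).
Qed.

Lemma idl_eq_mem s t : forms s -> s =i t -> idl s = idl t.
Proof.
move=> hs st; have ht : forms t by move=> p; rewrite -st; apply: hs.
apply/seteqP; split; apply: idl_subset => // p pin; apply: idl_mem => //.
  by rewrite -st.
by rewrite st.
Qed.

Lemma primary_sub I P : I `<=` P -> primary I -> primary P.
Proof. by move=> le prI i; have [N IN] := prI i; exists N; apply: le. Qed.

Definition nzd I x : Prop := forall a, I (x * a) -> I a.

(** The head is regular modulo the tail, so that a sequence can be grown or
    modified at its head. *)
Fixpoint reg s : Prop := if s is h :: s' then nzd (idl s') h /\ reg s' else True.

(** Graded Nakayama: the annihilator A of x modulo I satisfies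
    A = y A + I, and y has positive degree. *)
Lemma nzd_swap1 I x y : hideal I -> form x -> form y ->
  nzd I y -> nzd (adjoin y I) x -> nzd I x.
Proof.
move=> hI [k _ hx] [e e0 hy] ny nx.
suff H d a : a \is d.-homog -> I (x * a) -> I a.
  move=> a xa; apply: (hideal_of_hpart hI) => d.
  apply: (H d); first exact: pihomogP.
  have := hideal_hpart hI (d + k) xa.
  by rewrite mulrC (hpart_mul_ge _ hx) ?leq_addl // addnK mulrC.
elim/ltn_ind: d a => d IH a ha xa.
have [|u Iu] := nx a; first exact: adjoin_sub.
have := hideal_hpart hI d Iu; rewrite pihomogB (pihomog_dE ha).
have [led|ltd] := leqP e d; last first.
  by rewrite (hpart_mul_lt _ hy ltd) subr0.
rewrite (hpart_mul_ge _ hy led); set w := hpart _ u => Iw.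
have hw : w \is (d - e).-homog by apply: pihomogP.
have Iwx : I w.
  apply: (IH (d - e)%N _ w hw); first by rewrite -subn_gt0 subKn.
  apply: ny; have -> : y * (x * w) = x * a - x * (a - w * y) by ring.
  by apply: (hidealB hI) => //; apply: (hidealM hI).
rewrite -(subrK (w * y) a); apply: (hidealD hI) => //.
by rewrite mulrC; apply: (hidealM hI).
Qed.

Lemma nzd_swap2 I x y : hideal I ->
  nzd I y -> nzd (adjoin y I) x -> nzd (adjoin x I) y.
Proof.
move=> hI ny nx a [b Ib].
have [|b' Ib'] := nx b.
  exists a; have -> : x * b - a * y = - (y * a - b * x) by ring.
  exact: (hidealN hI).
exists b'; apply: ny.
have -> : y * (a - b' * x) = y * a - b * x + x * (b - b' * y) by ring.
by apply: (hidealD hI) => //; apply: (hidealM hI).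
Qed.

Lemma reg_swap x y s : forms (x :: y :: s) -> reg (x :: y :: s) ->
  reg (y :: x :: s).
Proof.
move=> /forms_cons[hx /forms_cons[hy hs]] [nx [ny rs]].
have hI := hideal_idl hs; split; first exact: nzd_swap2.
by split=> //; apply: nzd_swap1 hy _ _.
Qed.

Lemma reg_move g X G : forms (g :: X ++ G) ->
  reg (g :: X ++ G) <-> reg (X ++ g :: G).
Proof.
elim: X => [//|x X IH] hf; have [hg hx'] := forms_cons hf.
have [hx hXG] := forms_cons hx'.
have hf' : forms (x :: g :: X ++ G) by apply: formsC => //; apply: formsC.
have hfg : forms (g :: X ++ G) by apply: formsC.
have E : idl (g :: X ++ G) = idl (X ++ g :: G).
  by apply: idl_eq_mem => // p; rewrite inE !mem_cat inE orbCA.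
have IH' := IH hfg.
split=> [/(reg_swap hf)[nx rg]|[nx rg]].
  by split; [rewrite -E|apply/IH'].
by apply: reg_swap => //; split; [rewrite -E in nx|apply/IH'].
Qed.

(** A graded Artinian Gorenstein quotient is one in which some functional of
    degree sig, the socle degree, induces a perfect pairing.  Here the functional
    is written p |-> coefficient of D * p at mm; this covers every case that
    arises, since each functional is obtained from the one of a monomial
    complete intersection by multiplications. *)
Definition gorenstein I (sig : nat) : Prop :=
  exists D (mm : 'X_{1..n}) del, [/\ (D : R) \is del.-homog,
    (del + sig = mdeg mm)%N
    & forall a, I a <-> forall b, (D * a * b)@_mm = 0].

(** When z = c g modulo I, multiplication by c embeds R/(I, g) into R/(I, z), so
    the functional of the latter composed with c serves for the former. This is
    linkage, one generator at a time. *)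
Lemma exchange I z g c N e (t : nat) :
  hideal I -> (0 < e)%N -> (e <= N)%N -> c \is (N - e).-homog ->
  I (z - c * g) -> nzd I z -> gorenstein (adjoin z I) (N.-1 + t) ->
  nzd I g /\ gorenstein (adjoin g I) (t + e.-1).
Proof.
move=> hI e0 leN hc Iz nz [D [mm [del [hD degD HD]]]].
have nc : nzd I c.
  move=> a ca; apply: nz.
  have -> : z * a = a * (z - c * g) + g * (c * a) by ring.
  by apply: (hidealD hI); apply: (hidealM hI).
split=> [a ga|].
  apply: nz; have -> : z * a = a * (z - c * g) + c * (g * a) by ring.
  by apply: (hidealD hI); apply: (hidealM hI).
exists (c * D), mm, (N - e + del)%N; split.
- exact: dhomogM.
- by rewrite -degD; lia.
- move=> a; have -> : (adjoin g I a) <-> adjoin z I (c * a).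
    split=> -[u Iu]; exists u.
      have -> : c * a - u * z = c * (a - u * g) - u * (z - c * g) by ring.
      by apply: (hidealB hI); apply: (hidealM hI).
    apply: nc; have -> : c * (a - u * g) = c * a - u * z + u * (z - c * g) by ring.
    by apply: (hidealD hI) => //; apply: (hidealM hI).
  by rewrite HD; split=> H b; have := H b; rewrite mulrA [c * D]mulrC.
Qed.

End Regular.

(** * Powers of the variables *)

Section Monomials.
Variables (K : fieldType) (n : nat).
Local Notation R := {mpoly K[n]}.
Implicit Types (N : 'I_n -> nat) (js : seq 'I_n) (G : seq R).

Definition powers N js : seq R := [seq 'X_i ^+ N i | i <- js].

Lemma forms_powers N js : (forall i, (0 < N i)%N) -> forms (powers N js).
Proof.
move=> N0 _ /mapP[i _ ->]; exists (N i) => //.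
by rewrite -[X in X.-homog]mul1n; apply: dhomogMn; rewrite dhomogX /= mdeg1.
Qed.

(** An ideal of monomials is determined by the supports of its elements. *)
Lemma idl_powers N js p : (forall i, (0 < N i)%N) ->
  idl (powers N js) p <->
  forall m, m \in msupp p -> exists2 i, i \in js & (N i <= m i)%N.
Proof.
move=> N0; have hI := hideal_idl (forms_powers (js := js) N0); split; last first.
  move=> H; rewrite [p]mpolyE big_seq; apply: (hideal_sum hI) => m /H[i ijs le].
  apply: (hidealZ hI).
  have -> : m = (m - U_(i) *+ N i + U_(i) *+ N i)%MM.
    rewrite submK //; apply/mnm_lepP => j; rewrite mulmnE mnm1E.
    by case: eqP => [<-|_]; rewrite ?mul1n.
  rewrite mpolyXD -mpolyXn; apply: (hidealM hI).
  apply: idl_mem; first exact: forms_powers.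
  by apply/mapP; exists i.
move: p; apply: idl_sub => [m|p q Ip Iq m /msuppD_le|u p Ip m /msuppM_le|].
- by rewrite msupp0.
- by rewrite mem_cat => /orP[/Ip|/Iq].
- case/allpairsP => -[m1 m2] /= [_ /Ip[i ijs le] ->]; exists i => //.
  by rewrite mnmDE; apply: leq_trans le (leq_addl _ _).
- move=> _ /mapP[i ijs ->] m; rewrite mpolyXn msuppX inE => /eqP->; exists i => //.
  by rewrite mulmnE mnm1E eqxx mul1n.
Qed.

Lemma reg_powers N js : (forall i, (0 < N i)%N) -> uniq js ->
  reg (powers N js).
Proof.
move=> N0; elim: js => [//|i js IH] /= /andP[njs /IH ris]; split=> // a.
move=> /(idl_powers _ _ N0) H; apply/(idl_powers _ _ N0) => m ma.
have [|j jjs] := H (U_(i) *+ N i + m)%MM.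
  by rewrite mcoeff_msupp mulrC mpolyXn mcoeffMX -mcoeff_msupp.
rewrite mnmDE mulmnE mnm1E; case: eqP => [ij|_]; first by rewrite ij jjs in njs.
by exists j.
Qed.

(** The functional reads the coefficient of the socle monomial, the product of
    the x_i^(N_i - 1). *)
Lemma gorenstein_powers N js : (forall i, (0 < N i)%N) ->
  perm_eq js (enum 'I_n) ->
  gorenstein (idl (powers N js)) (\sum_(i <- js) (N i).-1).
Proof.
move=> N0 pis; exists 1, [multinom (N i).-1 | i < n], 0%N; split.
- exact: dhomog1.
- rewrite add0n mdegE (perm_big _ pis) big_enum /=.
  by apply: eq_bigr => i _; rewrite mnmE.
have hI := hideal_idl (forms_powers (js := js) N0).
move=> a; split=> [Ia b|H].
  apply/eqP; apply: contraT; rewrite mul1r -mcoeff_msupp => mab.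
  have : idl (powers N js) (a * b) by rewrite mulrC; apply: (hidealM hI).
  move/(idl_powers _ _ N0) => /(_ _ mab)[i _]; rewrite mnmE.
  by case: (N i) (N0 i) => // k _; rewrite ltnn.
apply/(idl_powers _ _ N0) => m ma; apply: contrapT => nex.
have le : (m <= [multinom (N i).-1 | i < n])%MM.
  apply/mnm_lepP => i; rewrite mnmE -ltnS prednK // ltnNge; apply/negP => le.
  by apply: nex; exists i; rewrite // (perm_mem pis) mem_enum.
have := H 'X_[([multinom (N i).-1 | i < n] - m)%MM].
rewrite mul1r -{1}(submK le) mcoeffMX => /eqP.
by rewrite mcoeff_eq0 ma.
Qed.

End Monomials.

(** * Complete intersections inside an ideal *)

Section Systems.
Variables (K : closedFieldType) (n : nat).
Local Notation R := {mpoly K[n]}.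
Implicit Types (I : set R) (s G F : seq R) (N : 'I_n -> nat) (js : seq 'I_n).
Implicit Types (v : 'I_n -> K).

Lemma zero_locus_idl s v : forms s ->
  zero_locus (idl s) v <-> {in s, forall p, p.@[v] = 0}.
Proof.
move=> hs; split=> [H p ps|H]; first by apply: H; apply: idl_mem.
apply: (@idl_sub _ _ s [set p | p.@[v] = 0]) => //=.
- exact: meval0.
- by move=> p q p0 q0; rewrite mevalD p0 q0 addr0.
- by move=> u p p0; rewrite mevalM p0 mulr0.
Qed.

Lemma primary_idl s : forms s ->
  primary (idl s) <->
  (forall v, {in s, forall p, p.@[v] = 0} -> v = fun=> 0).
Proof.
move=> hs; split=> [prs v|H]; first by move/(zero_locus_idl _ hs)/(primary_zero prs).
apply: Nullstellensatz; first exact: hideal_idl.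
by move=> v /(zero_locus_idl _ hs)/H.
Qed.

Definition xs js : seq R := [seq 'X_i | i <- js].

Lemma forms_xs js : forms (xs js).
Proof. by move=> _ /mapP[i _ ->]; exists 1%N; rewrite // dhomogX /= mdeg1. Qed.

Lemma powers_zero N js v : (forall i, (0 < N i)%N) ->
  {in powers K N js, forall p, p.@[v] = 0} -> {in xs js, forall p, p.@[v] = 0}.
Proof.
move=> N0 H _ /mapP[i ijs ->]; rewrite mevalXU.
have : ('X_i ^+ N i : R).@[v] = 0 by apply: H; apply/mapP; exists i.
rewrite rmorphXn /= mevalXU => /eqP; rewrite expf_eq0 => /andP[_ /eqP//].
Qed.

(** All exponents are considered at once because the power of x_i that lies in
    the ideal generated by the other elements and a new generator is only known
    after that generator has been chosen. *)
Definition exponent_free G js (sig : nat) : Prop :=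
  forall N, (forall i, (0 < N i)%N) ->
    reg (powers K N js ++ G)
    /\ gorenstein (idl (powers K N js ++ G)) (\sum_(i <- js) (N i).-1 + sig).

(** Some power of x_i is in the ideal obtained by putting g in its place, so
    [exchange] applies to this power and g. *)
Lemma exponent_free_step G i js sig g e :
  uniq (i :: js) -> forms G -> (0 < e)%N -> g \is e.-homog ->
  exponent_free G (i :: js) sig -> primary (idl (g :: xs js ++ G)) ->
  exponent_free (g :: G) js (sig + e.-1).
Proof.
move=> /andP[nijs ujs] hG e0 hg GR prg N N0.
set L := powers K N js ++ G.
have hL : forms L by apply: forms_cat => //; apply: forms_powers.
have hI := hideal_idl hL.
have fg : form g by exists e.
have : primary (idl (g :: L)).
  apply/primary_idl; first exact: formsC.
  move=> v H; have hg' : forms (g :: xs js ++ G).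
    by apply: formsC => //; apply: forms_cat => //; apply: forms_xs.
  apply: (iffLR (primary_idl hg') prg) => p.
  rewrite inE mem_cat => /or3P[/eqP->|pj|pG].
  - by apply: H; exact: mem_head.
  - apply: (powers_zero N0) pj => q qj; apply: H.
    by rewrite inE mem_cat qj orbT.
  - by apply: H; rewrite inE mem_cat pG !orbT.
move=> /(_ i)[M]; set x := 'X_i => Mx.
have hx : x \is 1.-homog by rewrite dhomogX /= mdeg1.
have {Mx} : idl (g :: L) (x ^+ (M + e)).
  exact: (hideal_expn_le (hideal_idl (formsC fg hL)) (leq_addr _ _)).
case=> u /(hideal_hpart hI (M + e)); rewrite pihomogB pihomog_dE; last first.
  by have := dhomogMn (M + e) hx; rewrite mul1n.
rewrite (hpart_mul_ge _ hg (leq_addl _ _)).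
set c := hpart _ u => Ic.
(* the exponent M + e makes both the power of x_i lie in the new ideal and the
   degree of its cofactor c nonnegative *)
pose N' j := if j == i then (M + e)%N else N j.
have N'0 j : (0 < N' j)%N by rewrite /N'; case: eqP => // _; rewrite addn_gt0 e0 orbT.
have N'E j : j \in js -> N' j = N j.
  by rewrite /N'; case: eqP => // -> ijs; rewrite ijs in nijs.
have pE : powers K N' js = powers K N js.
  by apply/eq_in_map => j /N'E ->.
have := GR N' N'0; rewrite /= pE -/L big_cons /N' eqxx.
rewrite (_ : \sum_(j <- js) _ = \sum_(j <- js) (N j).-1)%N; last first.
  by apply: eq_big_seq => j /N'E; rewrite /N' => ->.
case=> -[nx rL] gor; rewrite -addnA in gor.
have [ng gorg] := exchange hI e0 (leq_addl M e) (pihomogP mdeg _ u) Ic nx gor.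
split; first by apply/reg_move => //; apply: formsC.
have <- : idl (g :: L) = idl (powers K N js ++ g :: G).
  apply: idl_eq_mem; first exact: formsC.
  by move=> p; rewrite inE !mem_cat inE orbCA.
by rewrite addnA.
Qed.

Lemma exponent_free_powers js : perm_eq js (enum 'I_n) ->
  exponent_free [::] js 0.
Proof.
move=> pjs N N0; rewrite cats0 addn0; split; last exact: gorenstein_powers.
by apply: reg_powers => //; rewrite (perm_uniq pjs) enum_uniq.
Qed.

Lemma comb_idl (s : K) p F : forms (p :: F) -> forms (comb s (p :: F) :: F) ->
  idl (comb s (p :: F) :: F) = idl (p :: F).
Proof.
move=> hpF hcF; have [_ hF] := forms_cons hpF.
have cF : forall G, forms G -> {in F, forall q, idl G q} -> idl G (comb s F).
  move=> G hG; elim: F {hpF hcF hF} => [|q F IH] HF /=.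
    exact: hideal0 (hideal_idl hG).
  apply: (hidealD (hideal_idl hG)); first by apply: HF; exact: mem_head.
  apply: (hidealZ (hideal_idl hG)); apply: IH => r rF; apply: HF.
  by rewrite inE rF orbT.
apply/seteqP; split; apply: idl_subset => // q; rewrite inE => /orP[/eqP->|qF].
- apply: (hidealD (hideal_idl hpF)); first by apply: idl_mem => //; exact: mem_head.
  apply: (hidealZ (hideal_idl hpF)); apply: cF => // r rF.
  by apply: idl_mem => //; rewrite inE rF orbT.
- by apply: idl_mem => //; rewrite inE qF orbT.
- have pE : p - comb s (p :: F) = - (s *: comb s F) by rewrite /= opprD addNKr.
  apply: (hideal_cong (hideal_idl hcF) (q := comb s (p :: F))); last first.
    by apply: idl_mem => //; exact: mem_head.
  rewrite pE; apply: (hidealN (hideal_idl hcF)).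
  apply: (hidealZ (hideal_idl hcF)); apply: cF => // r rF.
  by apply: idl_mem => //; rewrite inE rF orbT.
- by apply: idl_mem => //; rewrite inE qF orbT.
Qed.

(** The variables are traded one by one for generic combinations of the
    remaining generators F.  Each combination replaces one element of F without
    changing the ideal, so that a single generator g is left over at the end. *)
Lemma exponent_free_chain e js : (0 < e)%N -> forall F G sig,
  size F = (size js).+1 -> uniq js -> forms G ->
  {in F, forall p, p \is e.-homog} -> exponent_free G js sig ->
  primary (idl (xs js ++ G)) -> primary (idl (F ++ G)) ->
  exists gs g, [/\ size gs = size js, {in g :: gs, forall p, p \is e.-homog},
    idl (g :: gs) = idl F
    & exponent_free (gs ++ G) [::] (sig + size js * e.-1)].
Proof.
move=> e0; elim: js => [|i js IH] F G sig sF ujs hG hF GR prx prF.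
  case: F sF hF prF => [//|g []//] _ hF prF; exists [::], g; split=> //.
  by rewrite mul0n addn0.
case: F sF hF prF => [//|p F] [sF] hF prF.
have fF : forms (p :: F) by move=> q qF; exists e; rewrite // hF.
set I := idl (xs js ++ G).
have hxG : forms (xs js ++ G) by apply: forms_cat => //; apply: forms_xs.
have hI : hideal I by apply: hideal_idl.
have hx : ('X_i : R) \is 1.-homog by rewrite dhomogX /= mdeg1.
have [|s prs] := generic_combination hI hx isT prx hF.
  move=> v /(zero_locus_idl _ hxG) HI HF.
  apply: (iffLR (primary_idl (forms_cat fF hG)) prF) => q.
  by rewrite mem_cat => /orP[/HF//|qG]; apply: HI; rewrite mem_cat qG orbT.
set g := comb s (p :: F) in prs.
have hg : g \is e.-homog by apply: comb_homog.
have fg : form g by exists e.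
have hF' : {in F, forall q, q \is e.-homog} by move=> q qF; apply: hF; rewrite inE qF orbT.
have fF' : forms F by have [] := forms_cons fF.
have gFE : idl (g :: F) = idl (p :: F).
  by apply: comb_idl => //; apply: formsC.
have GR' := exponent_free_step ujs hG e0 hg GR prs.
have [|||gs [g' [sgs hgs gsE GR'']]] := IH F (g :: G) _ sF _ (formsC fg hG) hF' GR'.
- by case/andP: ujs.
- apply: primary_sub prs; rewrite -[adjoin _ I]/(idl (g :: xs js ++ G)).
  apply: idl_subset.
    by apply: forms_cat; [apply: forms_xs|apply: formsC].
  move=> q qin; apply: idl_mem.
    by apply: forms_cat; [apply: forms_xs|apply: formsC].
  by move: qin; rewrite inE !mem_cat inE orbCA.
- apply: primary_sub prF.
  have fFgG : forms (F ++ g :: G) by apply: forms_cat => //; apply: formsC.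
  have E : idl (g :: F ++ G) = idl (F ++ g :: G).
    by apply/esym/idl_eq_mem => // q; rewrite inE !mem_cat inE orbCA.
  rewrite -E; have fgFG : forms (g :: F ++ G).
    by apply: formsC => //; apply: forms_cat.
  apply: idl_subset => // q; rewrite -cat_cons mem_cat => /orP[qF|qG].
    have : idl (g :: F) q by rewrite gFE; apply: idl_mem.
    apply: idl_subset => // r; rewrite inE => /orP[/eqP->|rF]; apply: idl_mem => //.
      exact: mem_head.
    by rewrite inE mem_cat rF orbT.
  by apply: idl_mem => //; rewrite inE mem_cat qG !orbT.
exists (rcons gs g), g'; split.
- by rewrite size_rcons sgs.
- move=> q; rewrite inE mem_rcons inE => /or3P[/eqP->|/eqP->//|qgs].
    by apply: hgs; exact: mem_head.
  by apply: hgs; rewrite inE qgs orbT.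
- have fgs : forms (g' :: gs) by move=> q qgs; exists e; rewrite // hgs.
  have fgs' : forms (g' :: rcons gs g).
    move=> q; rewrite inE mem_rcons inE orbCA -in_cons => /orP[/eqP->//|].
    exact: fgs.
  rewrite -gFE; have -> : idl (g' :: rcons gs g) = idl (g :: g' :: gs).
    by apply: idl_eq_mem => // q; rewrite !inE mem_rcons inE orbCA.
  by rewrite /= -[adjoin g' (idl gs)]/(idl (g' :: gs)) gsE.
- by rewrite cat_rcons mulSn addnA.
Qed.

(** The form z takes the place of the variable x_i, then the chain
    replaces the others: gs is a maximal regular sequence in the ideal of F, to
    which only g has to be added to recover this ideal. *)
Lemma gorenstein_presentation F (z : R) e (N : nat) i js :
  (0 < e)%N -> (0 < N)%N -> {in F, forall p, p \is e.-homog} ->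
  z \is N.-homog -> perm_eq (i :: js) (enum 'I_n) -> size F = n ->
  primary (idl (z :: xs js)) -> primary (adjoin z (idl F)) ->
  exists gs g, [/\ size gs = n.-1, {in g :: gs, forall p, p \is e.-homog},
    idl (g :: gs) = idl F, nzd (idl gs) z
    & gorenstein (adjoin z (idl gs)) (N.-1 + n.-1 * e.-1)].
Proof.
move=> e0 N0 hF hz pjs sF prz prF.
have uijs : uniq (i :: js) by rewrite (perm_uniq pjs) enum_uniq.
have snj : size js = n.-1.
  by have /(congr1 predn) /= := perm_size pjs; rewrite size_enum_ord.
have sjs : (size js).+1 = n.
  by have /= := perm_size pjs; rewrite size_enum_ord.
have fz : form z by exists N.
have fF : forms F by move=> q qF; exists e; rewrite // hF.
have f0 : forms ([::] : seq R) by [].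
have GR1 : exponent_free [:: z] js (0 + N.-1).
  apply: (exponent_free_step uijs f0 N0 hz (exponent_free_powers pjs)).
  by rewrite cats0.
have [|||||gs [g [sgs hgs gsE GR]]] := exponent_free_chain e0 _ _ _ hF GR1.
- by rewrite sF.
- by case/andP: uijs.
- exact: formsC.
- have -> // : idl (xs js ++ [:: z]) = idl (z :: xs js).
  apply: idl_eq_mem; first by apply: forms_cat; [apply: forms_xs|apply: formsC].
  by move=> q; rewrite inE mem_cat inE orbC.
- have -> // : idl (F ++ [:: z]) = idl (z :: F).
  apply: idl_eq_mem; first by apply: forms_cat => //; apply: formsC.
  by move=> q; rewrite inE mem_cat inE orbC.
exists gs, g; have fgs : forms gs.
  by move=> q qgs; exists e; rewrite // hgs // inE qgs orbT.
have [rz gz] := GR (fun=> 1%N) (fun=> isT).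
split=> //; first by rewrite sgs snj.
- have [|] := iffRL (@reg_move _ _ z gs [::] _) rz => //.
  by apply: formsC => //; rewrite cats0.
  by rewrite cats0.
- move: gz; rewrite /= big_nil !add0n snj.
  have -> // : idl (gs ++ [:: z]) = idl (z :: gs).
  apply: idl_eq_mem; first by apply: forms_cat => //; apply: formsC.
  by move=> q; rewrite inE mem_cat inE orbC.
Qed.

End Systems.

(** * The pairing on the torsion *)

Section Duality.
Variables (K : fieldType) (n : nat).
Local Notation R := {mpoly K[n]}.
Implicit Types (I : set R) (a b c g p q u y z : R) (mm : 'X_{1..n}).

(** Monomials of degree larger than that of mm do not contribute to the
    coefficient at mm. *)
Lemma mcoeff_monomial_test p mm :
  (forall m : 'X_{1..n}, (mdeg m <= mdeg mm)%N -> (p * 'X_[m])@_mm = 0) ->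
  forall b, (p * b)@_mm = 0.
Proof.
move=> H b; rewrite [b]mpolyE mulr_sumr raddf_sum big1 //= => m _.
rewrite -scalerAr mcoeffZ; have [le|lt] := leqP (mdeg m) (mdeg mm).
  by rewrite H // mulr0.
rewrite (_ : _@_mm = 0) ?mulr0 //; apply/eqP; rewrite mcoeff_eq0; apply/negP.
move=> /msuppM_le/allpairsP[[m1 m2] /= [_]]; rewrite msuppX inE => /eqP-> E.
by move: lt; rewrite E mdegD ltnNge leq_addl.
Qed.

(** In a Gorenstein quotient the annihilator of the annihilator of g is the
    ideal of g.  In linear algebra terms: the functional of a vanishes on the
    kernel of the matrix of g, hence is in its row space. *)
Lemma annihilator_duality I D mm g a :
  (forall a, I a <-> forall b, (D * a * b)@_mm = 0) ->
  (forall y, I (g * y) -> (D * a * y)@_mm = 0) -> adjoin g I a.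
Proof.
move=> HD Ha; pose T := 'X_{1..n < (mdeg mm).+1}.
pose mon (t : 'I_#|{: T}|) : R := 'X_[bmnm (enum_val t)].
have montest p : (forall t, (p * mon t)@_mm = 0) -> forall b, (p * b)@_mm = 0.
  move=> H; apply: mcoeff_monomial_test => m lem.
  have ltm : (mdeg m < (mdeg mm).+1)%N by rewrite ltnS.
  have := H (enum_rank (Sub m ltm : T)); by rewrite /mon enum_rankK.
pose G : 'M[K]_(#|{: T}|) := \matrix_(s, t) (D * g * mon s * mon t)@_mm.
pose rho : 'rV[K]_(#|{: T}|) := \row_t (D * a * mon t)@_mm.
have /submxP[u rhoE] : (rho <= G)%MS.
  rewrite submxE; apply/eqP/matrixP => i0 j; rewrite ord1 [RHS]mxE.
  pose w := cokermx G; pose Y : R := \sum_t w t j *: mon t.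
  have IgY : I (g * Y).
    apply/HD; apply: montest => s.
    have /matrixP/(_ s j) := mulmx_coker G; rewrite !mxE => E.
    rewrite -[RHS]E /Y !mulr_sumr mulr_suml raddf_sum.
    apply: eq_bigr => t _ /=; rewrite !mxE -!scalerAr -scalerAl mcoeffZ mulrC.
    by congr ((mcoeff _ _) * _); ring.
  have := Ha Y IgY; rewrite /Y mulr_sumr raddf_sum => E.
  rewrite !mxE -[RHS]E; apply: eq_bigr => t _ /=.
  by rewrite !mxE -scalerAr mcoeffZ mulrC.
exists (\sum_s u 0 s *: mon s); apply/HD; apply: montest => t.
have /matrixP/(_ 0 t) := rhoE; rewrite !mxE => E.
rewrite mulrBr mulrBl mcoeffB E; apply/eqP; rewrite subr_eq0; apply/eqP.
rewrite mulr_suml mulr_sumr mulr_suml raddf_sum; apply: eq_bigr => s _ /=.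
rewrite !mxE -scalerAl -scalerAr -scalerAl mcoeffZ; congr (_ * mcoeff _ _); ring.
Qed.

Lemma mcoeff_mul_homog k p y mm : p \is k.-homog ->
  (p * y)@_mm = if (k <= mdeg mm)%N then (p * hpart (mdeg mm - k) y)@_mm else 0.
Proof.
move=> hp.
have mE q : q@_mm = (hpart (mdeg mm) q)@_mm.
  rewrite {1}[q]hpart_sum raddf_sum /=.
  have nz (d : nat) : d != mdeg mm -> (hpart d q)@_mm = 0.
    by move=> nd; apply: (dhomog_nemf_coeff (pihomogP mdeg d q)); rewrite eq_sym.
  have [lt|le] := ltnP (mdeg mm) (msize q).
    by rewrite (bigD1 (Ordinal lt)) //= big1 ?addr0 // => d nd; apply: nz.
  rewrite big1 => [|d _]; last by apply: nz; rewrite ltn_eqF // (leq_trans _ le).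
  have [->|q0] := eqVneq (hpart (mdeg mm) q) 0; first by rewrite mcoeff0.
  apply/esym/eqP; rewrite mcoeff_eq0; apply/negP => mq.
  suff : q@_mm = 0.
    move=> qm; move: mq; rewrite mcoeff_msupp /pihomog raddf_sum /= big1_seq ?eqxx //.
    move=> m /andP[_ mq]; rewrite mcoeffZ mcoeffX; case: eqP => [->|_].
      by rewrite qm mul0r.
    by rewrite mulr0.
  by apply/eqP; rewrite mcoeff_eq0; apply/negP => /msize_mdeg_lt; rewrite ltnNge le.
rewrite mE mulrC; case: leqP => [le|lt]; last by rewrite (hpart_mul_lt _ hp lt) mcoeff0.
by rewrite (hpart_mul_ge _ hp le) mulrC.
Qed.

(** With J = (I, g), the classes killed by z in R/J are paired as follows: if
    z q = g q' modulo I, the value on (p, q) is the functional of R/(I, z) at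
    p q'.  If a combination a of the p_i is orthogonal to all q_j, then a is
    orthogonal to the annihilator of g in R/(I, z): when g w = b z modulo I, the
    element b is again killed by z in R/J, hence a combination of the q_j modulo
    J, so w is the same combination of the q'_j up to a multiple of z and an
    element annihilated by g, and both are orthogonal to a.  By
    [annihilator_duality] a is in (I, g, z), and for degree reasons in J.  So the
    pairing matrix has independent rows. *)
Lemma pairing_ineq I g z e N sig e1 (T : int) r s
    (p : 'I_r -> R) (q : 'I_s -> R) :
  hideal I -> g \is e.-homog -> z \is N.-homog -> nzd I z ->
  gorenstein (adjoin z I) sig -> (e1 < N)%N ->
  (T = (sig + e)%N%:Z - N%:Z)%R ->
  (forall i, p i \is e1.-homog) -> (forall i, adjoin g I (z * p i)) ->
  (forall c : 'I_r -> K, adjoin g I (\sum_i c i *: p i) -> forall i, c i = 0) ->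
  (forall j, adjoin g I (z * q j)) ->
  (forall b, zhomog (T - e1%:Z) b -> adjoin g I (z * b) ->
     exists c : 'I_s -> K, adjoin g I (b - \sum_j c j *: q j)) ->
  (r <= s)%N.
Proof.
move=> hI hg hz nz [D [mm [del [hD degD HD]]]] lte1 TE hp Jp indp Jq spanq.
have hJ : hideal (adjoin g I) := hideal_adjoin hI hg.
have hA : hideal (adjoin z I) := hideal_adjoin hI hz.
have /boolp.choice[q' Hq'] := Jq.
pose M : 'M[K]_(r, s) := \matrix_(i, j) (D * p i * q' j)@_mm.
suff /eqP fM : row_free M by rewrite -fM; apply: rank_leq_col.
rewrite -kermx_eq0; apply/eqP; apply/eqP; apply/rowV0P => v /sub_kermxP vM.
pose a := \sum_i v 0 i *: p i.
have ha : a \is e1.-homog by apply: rpred_sum => i _; apply: rpredZ.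
have aq j : (D * a * q' j)@_mm = 0.
  have /matrixP/(_ 0 j) := vM; rewrite !mxE => E; rewrite -[RHS]E.
  rewrite mulr_sumr mulr_suml raddf_sum; apply: eq_bigr => i _ /=.
  by rewrite mxE -scalerAr -scalerAl mcoeffZ.
have [a' Ia'] : adjoin g I (z * a).
  rewrite mulr_sumr; apply: (hideal_sum hJ) => i _.
  by rewrite -scalerAr; apply: (hidealZ hJ).
have : adjoin g (adjoin z I) a.
  apply: (annihilator_duality HD) => y gy.
  rewrite (mcoeff_mul_homog _ _ (dhomogM hD ha)); case: leqP => // lee1.
  have E1 : (mdeg mm - (del + e1) = sig - e1)%N by rewrite -degD subnDl.
  rewrite E1; set w := hpart _ y.
  have e1s : (e1 <= sig)%N by move: lee1; rewrite -degD leq_add2l.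
  have gw : adjoin z I (g * w).
    have := hideal_hpart hA (sig - e1 + e) gy.
    by rewrite mulrC (hpart_mul_ge _ hg (leq_addl _ _)) addnK mulrC.
  have hgw : g * w \is (e + (sig - e1)).-homog by apply: dhomogM => //; apply: pihomogP.
  have [b zb Ib] : exists2 b, zhomog (T - e1%:Z) b & I (g * w - b * z).
    case: gw => b0 /(hideal_hpart hI (e + (sig - e1))).
    rewrite pihomogB (pihomog_dE hgw).
    have [leN|ltN] := leqP N (e + (sig - e1)).
      rewrite (hpart_mul_ge _ hz leN) => Ib; exists (hpart (e + (sig - e1) - N) b0) => //.
      have -> : T - e1%:Z = (e + (sig - e1) - N)%N by lia.
      exact: pihomogP.
    rewrite (hpart_mul_lt _ hz ltN) => Ib; exists 0; last by rewrite mul0r.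
    by case: (T - e1%:Z) => // k; apply: rpred0.
  have [c [u Iu]] : exists c : 'I_s -> K, adjoin g I (b - \sum_j c j *: q j).
    apply: spanq => //; exists w.
    have -> : z * b - w * g = - (g * w - b * z) by ring.
    exact: (hidealN hI).
  set k := w - \sum_j c j *: q' j - u * z.
  have Igk : I (g * k).
    have -> : g * k = (g * w - b * z) + z * (b - \sum_j c j *: q j - u * g)
        + \sum_j c j *: (z * q j - q' j * g).
      rewrite /k; have -> : \sum_j c j *: (z * q j - q' j * g) =
          z * (\sum_j c j *: q j) - (\sum_j c j *: q' j) * g.
        rewrite mulr_sumr mulr_suml -sumrB; apply: eq_bigr => j _.
        by rewrite scalerBr scalerAr scalerAl.
      ring.
    apply: (hidealD hI); last first.
      by apply: (hideal_sum hI) => j _; apply: (hidealZ hI); apply: Hq'.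
    by apply: (hidealD hI) => //; apply: (hidealM hI).
  have Iak : I (a * k).
    apply: nz; have -> : z * (a * k) = k * (z * a - a' * g) + a' * (g * k) by ring.
    by apply: (hidealD hI); apply: (hidealM hI).
  have -> : D * a * w = D * (a * k) * 1 + D * z * (a * u)
      + \sum_j c j *: (D * a * q' j).
    have -> : \sum_j c j *: (D * a * q' j) = D * a * \sum_j c j *: q' j.
      by rewrite [RHS]mulr_sumr; apply: eq_bigr => j _; rewrite scalerAr.
    rewrite /k; ring.
  rewrite !mcoeffD raddf_sum /= big1 => [|j _]; last by rewrite mcoeffZ aq mulr0.
  rewrite (iffLR (HD _)) ?(iffLR (HD z)) ?addr0 //.
    exact: (adjoin_gen hI).
  exact: adjoin_sub.
case=> x [t It]; have Ja : adjoin g I a.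
  have := hideal_hpart hI e1 It.
  rewrite pihomogB (hpart_mul_lt _ hz lte1) subr0 pihomogB (pihomog_dE ha) => I1.
  rewrite -(subrK (hpart e1 (x * g)) a); apply: (hidealD hJ).
    exact: adjoin_sub.
  by apply: (hideal_hpart hJ); apply: (hidealM hJ); apply: (adjoin_gen hI).
by apply/rowP => i; rewrite mxE; apply: (indp (v 0)).
Qed.

End Duality.

(** * The module M and the Jacobian ideal *)

Section TopForms.
Variables (K : fieldType) (n : nat) (f : {mpoly K[n]}).
Local Notation R := {mpoly K[n]}.
Implicit Types (p q : R) (k : int).

Lemma full_index_card : #|[set: 'I_n]%SET| == n.
Proof. by rewrite cardsT card_ord. Qed.

Definition full_index : multi_index n n := exist _ [set: 'I_n]%SET full_index_card.

Lemma full_indexE (I : multi_index n n) : I = full_index.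
Proof.
apply: val_inj; apply/eqP; rewrite eqEcard finset.subsetT /= cardsT card_ord.
by case: I => I /= /eqP->.
Qed.

Definition top_form p : Omega K n n := [ffun _ => (p : {mpoly K[n]}^o)].

Lemma top_formK (w : Omega K n n) : top_form (w full_index) = w.
Proof. by apply/ffunP => I; rewrite ffunE [in RHS](full_indexE I). Qed.

Lemma top_formD p q : top_form (p + q) = top_form p + top_form q.
Proof. by apply/ffunP => I; rewrite !ffunE. Qed.

Lemma top_formZ p q : top_form (p * q) = p *: top_form q.
Proof. by apply/ffunP => I; rewrite !ffunE. Qed.

Lemma top_formB p q : top_form (p - q) = top_form p - top_form q.
Proof. by apply/ffunP => I; rewrite !ffunE. Qed.

Lemma top_form0 : top_form 0 = 0.
Proof. by apply/ffunP => I; rewrite !ffunE. Qed.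

(** M is R modulo this ideal; it is first defined through M, and identified
    with the ideal of the partial derivatives in [jacobian_idl]. *)
Definition jacobian : set R := [set p | Mclass f (top_form p) = 0].

Lemma Mclass0 : Mclass f 0 = 0.
Proof. by apply: (addrI (Mclass f 0)); rewrite -MclassD !addr0. Qed.

Lemma MclassN (w : Omega K n n) : Mclass f (- w) = - Mclass f w.
Proof. by apply: (addrI (Mclass f w)); rewrite -MclassD !subrr Mclass0. Qed.

Lemma Mclass_top_eq p q :
  Mclass f (top_form p) = Mclass f (top_form q) <-> jacobian (p - q).
Proof.
rewrite /jacobian /= top_formB MclassD MclassN.
by split=> [->|/eqP]; rewrite ?subrr // subr_eq0 => /eqP.
Qed.

Lemma scale_top p q :
  p *: Mclass f (top_form q) = Mclass f (top_form (p * q)).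
Proof. by rewrite top_formZ MclassZ. Qed.

Lemma jacobian0 : jacobian 0.
Proof. by rewrite /jacobian /= top_form0 Mclass0. Qed.

Lemma jacobianD p q : jacobian p -> jacobian q -> jacobian (p + q).
Proof.
by rewrite /jacobian /= top_formD MclassD => -> ->; rewrite addr0.
Qed.

Lemma jacobianM u p : jacobian p -> jacobian (u * p).
Proof.
rewrite /jacobian /= -scale_top => ->.
by apply: (addrI (u *: 0)); rewrite -scalerDr !addr0.
Qed.

Lemma jacobianP p :
  jacobian p <-> exists eta, top_form p = wedge n (differential f) (eta : Omega K n n.-1).
Proof.
split=> [|[eta E]].
  rewrite /jacobian /= => E.
  have /Mclass_eq[eta] : Mclass f (top_form p) = Mclass f 0 by rewrite Mclass0.
  by rewrite subr0; exists eta.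
rewrite /jacobian /= -Mclass0; apply/Mclass_eq; exists eta.
by rewrite subr0.
Qed.

Lemma differentialE (I : multi_index n 1) :
  differential f I = \sum_i f^`M(i) * (index_set I == [set i]%SET)%:R.
Proof.
rewrite /differential sum_ffunE; apply: eq_bigr => i _.
by rewrite !ffunE.
Qed.

(** Apply df to the (n-1)-form whose only coefficient is a 1 on the product of
    the dx_j with j <> i; the sign is removed afterwards. *)
Lemma jacobian_deriv i : jacobian (f^`M(i)).
Proof.
pose e := inversions [set i] (~: [set i]).
have H : jacobian ((-1) ^+ e * f^`M(i)).
  apply/jacobianP; exists [ffun J : multi_index n n.-1 =>
    ((index_set J == ~: [set i]%SET)%SET%:R : {mpoly K[n]}^o)].
  apply/ffunP => L; rewrite (full_indexE L) !ffunE.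
  have c1 : #|[set i]%SET| == 1%N by rewrite cards1.
  have c2 : #|(~: [set i])%SET| == n.-1 by rewrite cardsC1 card_ord.
  pose I0 : multi_index n 1 := exist _ [set i]%SET c1.
  pose J0 : multi_index n n.-1 := exist _ (~: [set i])%SET c2.
  rewrite (bigD1 I0) //= [X in _ + X]big1 ?addr0 => [|I nI]; last first.
    rewrite big1 // => J /andP[dIJ _]; rewrite ffunE.
    case: eqP => [JE|_]; last by rewrite mulr0.
    exfalso; move: nI => /negP; apply; apply/eqP/val_inj/eqP => /=.
    have cI : #|val I| = 1%N by apply/eqP/(valP I).
    rewrite eqEcard cards1 cI leqnn andbT.
    by move: dIJ; rewrite JE finset.disjoints_subset finset.setCK.
  rewrite (bigD1 J0) /=; last first.
    by rewrite -finset.setI_eq0 finset.setICr eqxx finset.setUCr eqxx.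
  rewrite [X in _ + X]big1 ?addr0 => [|J /andP[_ nJ]]; last first.
    rewrite ffunE; case: eqP => [JE|_]; last by rewrite mulr0.
    by move: nJ => /negP[]; apply/eqP/val_inj.
  rewrite ffunE eqxx mulr1 differentialE (bigD1 i) //= eqxx mulr1 big1 ?addr0 //.
  move=> j nj; rewrite (inj_eq finset.set1_inj) eq_sym (negPf nj) mulr0 //.
have := jacobianM ((-1) ^+ e) H.
by rewrite mulrA -exprMn mulrNN mulr1 expr1n mul1r.
Qed.

Definition partials : seq R := [seq f^`M(i) | i <- enum 'I_n].

Lemma jacobian_idl : forms partials -> jacobian = idl partials.
Proof.
move=> hF; have hI := hideal_idl hF.
apply/seteqP; split; last first.
  apply: idl_sub; [exact: jacobian0|exact: jacobianD|exact: jacobianM|].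
  by move=> _ /mapP[i _ ->]; apply: jacobian_deriv.
move=> p /jacobianP[eta /ffunP/(_ full_index)]; rewrite !ffunE => ->.
apply: (hideal_sum hI) => I _; apply: (hideal_sum hI) => J _.
rewrite mulrC; apply: (hidealM hI); apply: (hidealM hI).
rewrite differentialE; apply: (hideal_sum hI) => i _; rewrite mulrC.
apply: (hidealM hI); apply: idl_mem => //; apply/mapP; exists i => //.
by rewrite mem_enum.
Qed.

Definition torsion p : Prop := exists j0 : nat, forall j, (j0 <= j)%N ->
  forall u, ideal_pow (@irrelevant_ideal K n) j u -> jacobian (u * p).

Lemma torsionP p :
  local_cohomology0 (@irrelevant_ideal K n) (Mclass f (top_form p)) <-> torsion p.
Proof.
by split=> -[j0 H]; exists j0 => j lej u /(H j lej u); rewrite scale_top.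
Qed.

Lemma sum_top r (c : 'I_r -> K) (p : 'I_r -> R) :
  \sum_i (c i)%:A *: Mclass f (top_form (p i)) =
  Mclass f (top_form (\sum_i c i *: p i)).
Proof.
elim/big_rec2: _ => [|i q a _ ->]; first by rewrite top_form0 Mclass0.
rewrite scale_top top_formD MclassD; congr (Mclass f (top_form _) + _).
by rewrite -scalerAl mul1r.
Qed.

Lemma M'deg_top k p : zhomog (k - n%:Z) p -> torsion p ->
  M'deg f k (Mclass f (top_form p)).
Proof.
move=> hp tp; split; first exact/torsionP.
by exists (top_form p) => // I; rewrite ffunE.
Qed.

Lemma basis_polynomials k : exists p : 'I_(mu' f k) -> R,
  [/\ forall i, zhomog (k - n%:Z) (p i), forall i, torsion (p i),
    forall c : 'I_(mu' f k) -> K, jacobian (\sum_i c i *: p i) -> forall i, c i = 0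
  & forall b, zhomog (k - n%:Z) b -> torsion b ->
      exists c : 'I_(mu' f k) -> K, jacobian (b - \sum_i c i *: p i)].
Proof.
have [b [Sb ib gb]] := mu'_basis f k.
have /boolp.choice[p Hp] : forall i, exists p, zhomog (k - n%:Z) p
    /\ Mclass f (top_form p) = b i.
  move=> i; have [_ [w wk wb]] := Sb i; exists (w full_index); split.
    exact: wk.
  by rewrite top_formK.
exists p; split=> [i|i|c Jc|q hq tq].
- exact: (Hp i).1.
- by apply/torsionP; rewrite (Hp i).2; case: (Sb i).
- apply: ib; rewrite -[RHS]Jc -sum_top; apply: eq_bigr => i _.
  by rewrite (Hp i).2.
- have [c cE] := gb _ (M'deg_top hq tq); exists c.
  apply/Mclass_top_eq; rewrite cE -sum_top; apply: eq_bigr => i _.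
  by rewrite (Hp i).2.
Qed.

Lemma mu'_eq0 k : (forall p, zhomog (k - n%:Z) p -> jacobian p) -> mu' f k = 0%N.
Proof.
move=> H; have [p [hp _ ip _]] := basis_polynomials k.
case: (mu' f k) p hp ip => [//|r] p hp ip.
have /ip/(_ ord0)/eqP : jacobian (\sum_i (i == ord0)%:R *: p i).
  rewrite (bigD1 ord0) //= scale1r big1 ?addr0; first exact: H.
  by move=> i /negPf->; rewrite scale0r.
by rewrite oner_eq0.
Qed.

Lemma ideal_pow_mdeg j p : ideal_pow (@irrelevant_ideal K n) j p ->
  {in msupp p, forall m, (j <= mdeg m)%N}.
Proof.
elim: j p => [//|j IH] _ [r [a [b [Ia Ib ->]]]] m.
have hsum (s : seq 'I_r) : m \in msupp (\sum_(i <- s) a i * b i) -> (j < mdeg m)%N.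
  elim: s => [|i s IHs]; first by rewrite big_nil msupp0.
  rewrite big_cons => /msuppD_le; rewrite mem_cat => /orP[|/IHs//].
  move=> /msuppM_le/allpairsP[[m1 m2] /= [m1a /(IH _ (Ib i)) le ->]].
  rewrite mdegD -add1n leq_add //.
  have [g aE] := Ia i; move: m1a; rewrite aE.
  elim: (index_enum _) => [|l ls IHl]; first by rewrite big_nil msupp0.
  rewrite big_cons => /msuppD_le; rewrite mem_cat => /orP[|/IHl//].
  move=> /msuppM_le/allpairsP[[m3 m4] /= [_]]; rewrite msuppX inE => /eqP-> ->.
  by rewrite mdegD mdeg1 leq_addl.
exact: hsum.
Qed.

Lemma linear_irrelevant p : p \is 1.-homog -> @irrelevant_ideal K n p.
Proof.
move=> /dhomogP hp; exists (fun i => (p@_U_(i))%:MP).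
apply/mpolyP => m; rewrite raddf_sum /=.
under eq_bigr do rewrite mcoeffCM.
have [/eqP/mdeg1P[i /eqP mE]|m1] := eqVneq (mdeg m) 1%N.
  rewrite mE (bigD1 i) //= mcoeffXU eqxx mulr1 big1 ?addr0 // => j nj.
  by rewrite mcoeffXU (negPf nj) mulr0.
rewrite big1 => [|i _].
  apply/eqP; rewrite mcoeff_eq0; apply/negP => /hp /= mE.
  by rewrite mE eqxx in m1.
rewrite mcoeffX; case: eqP => [mE|_]; last by rewrite mulr0.
by rewrite -mE mdeg1 in m1.
Qed.

Lemma ideal_pow_expr j p : p \is 1.-homog ->
  ideal_pow (@irrelevant_ideal K n) j (p ^+ j).
Proof.
move=> hp; elim: j => [//|j IH] /=.
exists 1%N, (fun=> p), (fun=> p ^+ j); split=> //.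
  by move=> _; apply: linear_irrelevant.
by rewrite big_ord1 exprS.
Qed.

End TopForms.

(** * Symmetry of the dimensions *)

Section Symmetry.
Variables (K : closedFieldType) (n : nat) (f : {mpoly K[n]}) (d : nat).
Local Notation R := {mpoly K[n]}.
Hypothesis hf : f \is d.-homog.

Lemma mderiv_homog i : f^`M(i) \is d.-1.-homog.
Proof.
apply/dhomogP => m; rewrite mcoeff_msupp mcoeff_deriv => nz.
have : (m + U_(i))%MM \in msupp f.
  by rewrite mcoeff_msupp; apply: contra nz => /eqP->; rewrite mul0rn.
by move/(dhomogP _ _ _ hf) => /= <-; rewrite mdegD mdeg1 addn1.
Qed.

(** With N + 1 the degree of z: the socle degree N + (n-1)(d-2) of the
    complete intersection, plus deg g - deg z, minus the degree k - n of the
    first argument of the pairing, is the degree of the second one. *)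
Lemma dual_degree (N e1 : nat) (k : int) : (0 < n)%N -> (1 < d)%N ->
  k - n%:Z = e1%:Z ->
  (N + n.-1 * d.-2 + d.-1)%N%:Z - N.+1%:Z - e1%:Z = (n * d)%N%:Z - k - n%:Z.
Proof.
case: (n) => // n' _; case: (d) => [//|[//|d']] _ kn.
have -> : k = e1%:Z + n'.+1%:Z by rewrite -kn subrK.
by rewrite /=; lia.
Qed.

(** The power z = l^N of a linear form is chosen with N large enough to kill both
    torsion spaces modulo J and to exceed the degree k - n; then, in the two
    degrees at hand, the elements killed by z are exactly the torsion, and
    [pairing_ineq] applies. *)
Lemma mu'_le k : (0 < n)%N -> (1 < d)%N -> finite_lines (idl (partials f)) ->
  (mu' f k <= mu' f ((n * d)%N%:Z - k)%R)%N.
Proof.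
move=> n0 d1 flJ.
have e0 : (0 < d.-1)%N by rewrite -ltnS prednK // ltnW.
have hF : {in partials f, forall p, p \is d.-1.-homog}.
  by move=> _ /mapP[i _ ->]; apply: mderiv_homog.
have fF : forms (partials f) by move=> p pF; exists d.-1; rewrite // hF.
have hI := hideal_idl fF.
have JE := jacobian_idl fF.
have [s prs] := finite_lines_section hI flJ.
set l := comb s (vars K n) in prs.
have hl : l \is 1.-homog by apply: comb_homog; apply: vars_homog.
have [p [hp tp ip gp]] := basis_polynomials f k.
have [q [hq tq iq gq]] := basis_polynomials f ((n * d)%N%:Z - k).
rewrite JE in ip gp gq.
case kn : (k - n%:Z) hp gp => [e1|m] hp gp; last first.
  by rewrite mu'_eq0 // => p'; rewrite kn => /= ->; apply: jacobian0.
have /boolp.choice[j1 Hj1] := tp; have /boolp.choice[j2 Hj2] := tq.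
(* the summand e1 makes the degree of z larger than that of the p_i *)
pose N := (e1 + \max_i j1 i + \max_j j2 j).+1.
pose z := l ^+ N.
have hz : z \is N.-homog by have := dhomogMn N hl; rewrite mul1n.
have fz : form z by exists N.
have Jp i : idl (partials f) (z * p i).
  rewrite -JE; apply: (Hj1 i N); last exact: ideal_pow_expr.
  by apply: leq_trans (leq_bigmax i) _; rewrite /N; lia.
have Jq i : idl (partials f) (z * q i).
  rewrite -JE; apply: (Hj2 i N); last exact: ideal_pow_expr.
  by apply: leq_trans (leq_bigmax i) _; rewrite /N; lia.
have prz : primary (adjoin z (idl (partials f))).
  apply: Nullstellensatz; first exact: (hideal_adjoin hI hz).
  move=> v /(zero_locus_adjoin _ _ (hideal0 hI))[Jv zv].
  apply: (primary_zero prs); apply/(zero_locus_adjoin _ _ (hideal0 hI)); split=> //.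
  by move: zv; rewrite rmorphXn /= => /eqP; rewrite expf_eq0 => /andP[_ /eqP].
have [i0 [js eE]] : exists i0 js, enum 'I_n = i0 :: js.
  case E : (enum 'I_n) => [|i0 js]; last by exists i0, js.
  by move: (size_enum_ord n); rewrite E => n00; rewrite -n00 in n0.
have przx : primary (idl (z :: xs K js)).
  apply/primary_idl; first by apply: formsC => //; apply: forms_xs.
  move=> v H; have Hx : {in xs K js, forall p, p.@[v] = 0}.
    by move=> x xin; apply: H; rewrite inE xin orbT.
  have lv : l.@[v] = 0.
    have : z.@[v] = 0 by apply: H; exact: mem_head.
    by rewrite rmorphXn /= => /eqP; rewrite expf_eq0 => /andP[_ /eqP].
  apply: vars_zero => x; rewrite /vars eE inE => /orP[/eqP->|]; last exact: Hx.
  move: lv; rewrite /l /vars eE /= mevalD mevalZ.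
  suff -> : (comb s (xs K js)).@[v] = 0 by rewrite mulr0 addr0.
  elim: (xs K js) Hx => [|x' X IH] HX /=; first exact: meval0.
  rewrite mevalD mevalZ HX ?mem_head // IH ?mulr0 ?addr0 // => y yX.
  by apply: HX; rewrite inE yX orbT.
have pE : perm_eq (i0 :: js) (enum 'I_n) by rewrite eE.
have sF : size (partials f) = n by rewrite size_map size_enum_ord.
have [gs [g [sgs hgs gsE nz gor]]] :=
  gorenstein_presentation e0 (ltn0Sn _) hF hz pE sF przx prz.
have hgI : hideal (idl gs).
  by apply: hideal_idl => x xin; exists d.-1; rewrite // hgs // inE xin orbT.
have hg : g \is d.-1.-homog by apply: hgs; exact: mem_head.
have gE : adjoin g (idl gs) = idl (partials f) by [].
have torsJ b : idl (partials f) (z * b) -> torsion f b.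
  move=> zb; have hA := hideal_adjoin hI hz.
  have [N2 HN2] := primary_monomials hA prz; exists N2 => j lej u.
  move=> /ideal_pow_mdeg Hu; rewrite JE.
  have [w Iw] : adjoin z (idl (partials f)) u.
    rewrite [u]mpolyE big_seq; apply: (hideal_sum hA) => m mu.
    by apply: (hidealZ hA); apply: HN2; apply: leq_trans lej (Hu m mu).
  have -> : u * b = b * (u - w * z) + w * (z * b) by ring.
  by apply: (hidealD hI); apply: (hidealM hI).
apply: (pairing_ineq hgI hg hz nz gor (e1 := e1) (p := p) (q := q) _ erefl);
  rewrite ?gE //.
- by rewrite /N ltnS -addnA leq_addr.
- move=> b zb Jb; apply: gq (torsJ _ Jb).
  move: zb; congr (zhomog _ b).
  exact: dual_degree.
Qed.

(** For d <= 1 the partial derivatives are constants, so M = 0 as soon as one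
    of them is not 0. *)
Lemma low_degree_partial i : (d <= 1)%N -> f^`M(i) != 0 ->
  forall p, jacobian f p.
Proof.
move=> d1 fi p; have := mderiv_homog i.
have -> : d.-1 = 0%N by case: (d) d1 => // -[].
move=> h0; have cE : f^`M(i) = (f^`M(i)@_0)%:MP.
  apply/mpolyP => m; rewrite mcoeffC; case: eqVneq => [->|m0].
    by rewrite mulr1.
  by rewrite mulr0 (dhomog_nemf_coeff h0) //= mdeg_eq0.
set c := f^`M(i)@_0 in cE.
have c0 : c != 0 by apply: contra fi => /eqP c0; rewrite cE c0 mpolyC0.
have -> : p = p * (c^-1)%:MP * f^`M(i).
  by rewrite cE -mulrA -mpolyCM mulVf // mulr1.
by apply: jacobianM; apply: jacobian_deriv.
Qed.

Lemma low_degree_constant : (d <= 1)%N -> (forall i, f^`M(i) = 0) ->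
  exists c, f = c%:MP.
Proof.
move=> d1 H; exists f@_0; apply/mpolyP => m; rewrite mcoeffC.
case: eqVneq => [->|m0]; first by rewrite mulr1.
rewrite mulr0; apply/eqP; apply: contraT => fm.
have mE := dhomogP _ _ _ hf m; rewrite /= mcoeff_msupp in mE.
have /eqP/mdeg1P[i /eqP iE] : mdeg m = 1%N.
  apply/eqP; rewrite eqn_leq {1}(mE fm) d1 lt0n mdeg_eq0 //.
move: fm; rewrite iE; have := mcoeff_deriv i 0 f.
by rewrite H mcoeff0 add0m mnm0E mulr1n => <-; rewrite eqxx.
Qed.

Lemma constant_fewer_variables c : (0 < n)%N ->
  polynomial_of_fewer_variables (c%:MP_[n] : R).
Proof.
move=> n0; exists 1%:M; first exact: unitmx1.
exists (Ordinal n0) => m; rewrite /linear_change comp_mpolyC.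
by rewrite msuppC; case: eqP => // _; rewrite inE => /eqP->; rewrite mnm0E.
Qed.

End Symmetry.

Lemma Sing_zero_locus (K : closedFieldType) (n : nat) (f : {mpoly K[n]}) :
  forms (partials f) -> Sing f = zero_locus (idl (partials f)).
Proof.
move=> hF; apply/seteqP; split=> v.
  by move=> H; apply/(zero_locus_idl _ hF) => _ /mapP[i _ ->]; apply: H.
move=> /(zero_locus_idl _ hF) H i; apply: H; apply/mapP; exists i => //.
by rewrite mem_enum.
Qed.

Theorem corollary1 (R : realType) (n d : nat) (f : {mpoly R[i][n]}) :
  (2 <= n)%N ->
  f \is d.-homog ->
  dim_le (Sing f) 1 ->
  ~ polynomial_of_fewer_variables f ->
  forall k : int, mu' f k = mu' f ((n * d)%N%:Z - k)%R.
Proof.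
move=> n2 hf dimS nfew k; have n0 : (0 < n)%N by apply: ltnW.
have [d1|d1] := leqP d 1.
  have [H|/existsNP[i /eqP fi]] := pselect (forall i, f^`M(i) = 0).
    have [c fE] := low_degree_constant hf d1 H.
    by case: nfew; rewrite fE; apply: constant_fewer_variables.
  by rewrite !mu'_eq0 // => p _; apply: (low_degree_partial hf d1 fi).
have fF : forms (partials f).
  move=> _ /mapP[i _ ->]; exists d.-1; last exact: mderiv_homog.
  by rewrite -ltnS prednK // ltnW.
have flJ : finite_lines (idl (partials f)).
  apply: dim_le1_finite_lines; first exact: hideal_idl.
  by rewrite -Sing_zero_locus.
apply/eqP; rewrite eqn_leq (mu'_le hf) //=.
by have := mu'_le hf ((n * d)%N%:Z - k) n0 d1 flJ; rewrite subKr.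
Qed.
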